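(* Let $H$ be a Hilbert space, let $E$ be a Hilbert $\mathcal{K}(H)$-module and let $e\in\mathcal{K}(H)$ be any minimal projection. Let $E_e=eE$ be the associated Hilbert space, and equip $R(E)$ and $R(E_e)$ (the spaces of densely defined closed operators on $E$ and on $E_e$, respectively) with the gap metric $d$. Then the map $$\psi:R(E)\to R(E_e),\qquad \psi(t)=t_e:=t|_{eDom(t)},$$ is an isometric operation preserving map of $R(E)$ onto $R(E_e)$; in particular $d(t,s)=d(\psi(t),\psi(s))$ for all $t,s\in R(E)$.
   Context: $\mathcal{K}(H)$ is the C*-algebra of compact operators on the Hilbert space $H$. Hilbert $\mathcal{K}(H)$-modules are left modules with $\mathcal{K}(H)$-valued inner product that is linear in the first variable. $E_e=eE=\{ex:x\in E\}$ is a Hilbert space with inner product $(x,y)=\mathrm{trace}(\langle x,y\rangle)$. $R(E)$ is the set of densely defined closed $\mathcal{K}(H)$-linear operators $t:Dom(t)\subseteq E\to E$ with $Dom(t)$ a dense submodule; over $\mathcal{K}(H)$ every such operator is automatically regular, meaning that $t^*$ is densely defined and $1+t^*t$ has dense range, and its graph $G(t)=\{(x,tx):x\in Dom(t)\}$ is orthogonally complemented in $E\oplus E$. $R(E_e)$ is the set of densely defined closed linear operators on the Hilbert space $E_e$. For $t\in R(E)$ one has $eDom(t)\subseteq E_e$, $eDom(t)$ is dense in $E_e$, and $t_e$ is the restriction of $t$ to $eDom(t)$, viewed as an operator in $E_e$. The gap metric is $d(t,s)=\|P_{G(t)}-P_{G(s)}\|$, where $P_{G(t)}$ is the orthogonal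 projection onto the graph of $t$ (in $E\oplus E$, respectively $E_e\oplus E_e$). ''Operation preserving'' means compatible with adjoints ($\psi(t^* )=\psi(t)^*$) and with scalar multiples, sums and compositions ($\psi(\lambda t)=\lambda\psi(t)$, $\psi(t+s)=\psi(t)+\psi(s)$, $\psi(ts)=\psi(t)\psi(s)$) whenever the operator $\lambda t$, $t+s$, $ts$, taken with its natural domain, again belongs to $R(E)$. *)

(* Defs.v *)
From HB Require Import structures.
From mathcomp Require Import all_boot all_order all_algebra finmap.
From mathcomp Require Import all_classical all_reals all_analysis.
From mathcomp Require Import complex.

Set Implicit Arguments.
Unset Strict Implicit.
Unset Printing Implicit Defensive.
Import Order.TTheory GRing.Theory Num.Theory.
Import numFieldNormedType.Exports.

Local Open Scope classical_set_scope.
Local Open Scope ring_scope.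

(* The scalar field is R[i]; definiteness follows from [hdot_norm]. *)
HB.mixin Record CompleteNormedModule_isHilbert (R : realType) H
    of CompleteNormedModule R[i] H := {
  hdot : H -> H -> R[i];
  hdotDl : forall x y z, hdot (x + y) z = hdot x z + hdot y z;
  hdotZl : forall c x y, hdot (c *: x) y = c * hdot x y;
  hdotC : forall x y, hdot y x = (hdot x y)^*%C;
  hdot_norm : forall x, `|x| ^+ 2 = hdot x x }.

#[short(type="hilbertType")]
HB.structure Definition Hilbert (R : realType) :=
  { H of CompleteNormedModule_isHilbert R H & CompleteNormedModule R[i] H }.

Definition compact_linear {R : realType} {H : hilbertType R} : {pred H -> H} :=
  fun a => `[< linear a /\ precompact (a @` [set x | `|x| <= 1]) >].

Section CompactLinearTheory.
Context {R : realType} {H : hilbertType R}.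
Implicit Types a b : H -> H.

Let precompact_sub (A B : set H) : A `<=` B -> compact B -> precompact A.
Proof.
move=> AB cB; have clB : closed B by exact: compact_closed (@norm_hausdorff _ _) cB.
by apply: precompact_subset AB _; rewrite precompact_closed.
Qed.

Let compact_norm_bounded (A : set H) :
  compact A -> exists M : R[i], forall x, A x -> `|x| < M.
Proof.
rewrite compact_cover => cA.
have [||D _ AD] := cA H setT (fun x => [set y | `|y| < `|x| + 1]).
- move=> x _; rewrite openE => p; rewrite /= -subr_gt0 => px.
  apply/nbhs_ballP; exists (`|x| + 1 - `|p|) => // q.
  rewrite -ball_normE /= ltrBrDr distrC; apply: le_lt_trans.
  by rewrite -{1}(subrK p q) ler_normD.
- by move=> x _; exists x => //=; rewrite ltrDl.
exists (\sum_(x <- D) (`|x| + 1)) => y /AD[x /= xD /lt_le_trans]; apply.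
by rewrite (big_fsetD1 x xD)/= lerDl sumr_ge0// => z _; rewrite addr_ge0.
Qed.

Lemma compact_linear_continuous a : compact_linear a -> continuous a.
Proof.
move=> /asboolP[la]; rewrite precompactE => /compact_norm_bounded[M aM].
pose f := GRing.isLinear.Build _ _ _ _ a la.
pose fL : {linear H -> H} := HB.pack a f.
apply: (@bounded_linear_continuous _ _ _ fL).
apply/ex_bound; exists M; apply/nbhs_normP; exists 1 => //= x.
rewrite /= sub0r normrN => x1; apply/ltW/aM/subset_closure.
by exists x => //=; exact: ltW.
Qed.

Lemma compact_linear_submod : GRing.submod_closed (@compact_linear R H).
Proof.
split=> [|c a b /asboolP[la ca] /asboolP[lb cb]]; apply/asboolP.
  have fE u : (0 : H -> H) u = 0 by [].
  split=> [k x y|]; first by rewrite !fE scaler0 addr0.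
  by apply: (@precompact_sub _ [set 0]); [move=> _ [x _ <-]|exact: compact_set1].
have fE u : (c *: a + b) u = c *: a u + b u by [].
split=> [k x y|].
  by rewrite !fE la lb !scalerDr !scalerA [c * k]mulrC addrACA.
move: ca cb; rewrite 2!precompactE => ca cb.
pose g (p : H * H) := c *: p.1 + p.2.
apply: (@precompact_sub _ (g @` (closure (a @` [set x | `|x| <= 1]) `*`
                                 closure (b @` [set x | `|x| <= 1])))).
  move=> _ [x x1 <-]; exists (a x, b x) => //=.
  by split; apply: subset_closure; exists x.
apply: continuous_compact; last exact: compact_setX.
apply: continuous_subspaceT => p; apply: cvgD; last exact: cvg_snd.
by apply: cvgZr; exact: cvg_fst.
Qed.

Lemma compact_linear_comp a b :
  a \in compact_linear -> b \in compact_linear -> a \o b \in compact_linear.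
Proof.
move=> ca; have := compact_linear_continuous ca => cta.
move: ca => /asboolP[la _] /asboolP[lb cb]; apply/asboolP.
split=> [k x y|]; first by rewrite /= lb la.
move: cb; rewrite precompactE => cb.
apply: (@precompact_sub _ (a @` closure (b @` [set x | `|x| <= 1]))).
  by move=> _ [x x1 <-]; exists (b x) => //; apply: subset_closure; exists x.
by apply: continuous_compact cb; exact: continuous_subspaceT.
Qed.

End CompactLinearTheory.

Section CompactOperators.
Context {R : realType} (H : hilbertType R).

HB.instance Definition _ :=
  GRing.isSubmodClosed.Build R[i] (H -> H) compact_linear
    (GRing.submod_closed_semi compact_linear_submod).

Record compact_op :=
  CompactOp { compact_op_fun :> H -> H; _ : compact_op_fun \in compact_linear }.

HB.instance Definition _ := [isSub for compact_op_fun].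
HB.instance Definition _ := [Choice of compact_op by <:].
HB.instance Definition _ := [SubChoice_isSubLmodule of compact_op by <:].

End CompactOperators.

Section CompactOperatorAlgebra.
Context {R : realType} {H : hilbertType R}.
Local Notation K := (compact_op H).
Implicit Types a e f : K.

Definition cop_mul a (b : K) : K := CompactOp (compact_linear_comp (valP a) (valP b)).

(* The library's norm on H takes its values in R[i], on the nonnegative reals. *)
Definition cop_norm a : R := sup [set complex.Re `|a u| | u in [set u | `|u| <= 1]].

Definition cop_adjoint a (b : K) := forall u v, hdot (a u) v = hdot u (b v).

Definition projection e := cop_mul e e = e /\ cop_adjoint e e.

(* [cop_mul e f = f] is the order f <= e of projections. *)
Definition minimal_projection e :=
  [/\ projection e, e != 0 &
      forall f, projection f -> cop_mul e f = f -> f = 0 \/ f = e].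

Definition orthonormal_basis (B : set H) :=
  [/\ (forall b, B b -> hdot b b = 1),
      (forall b b', B b -> B b' -> b <> b' -> hdot b b' = 0) &
      (forall x, (forall b, B b -> hdot x b = 0) -> x = 0)].

(* c is the unordered sum of the (a b, b), b in B, for every orthonormal
   basis B *)
Definition has_trace a (c : R[i]) := forall B, orthonormal_basis B ->
  forall eps : R[i], 0 < eps ->
  exists2 F0 : {fset H}, [set` F0] `<=` B &
    forall F : {fset H}, [set` F0] `<=` [set` F] -> [set` F] `<=` B ->
      `|\sum_(b <- F) hdot (a b) b - c| < eps.

(* 0 when a is not of trace class *)
Definition trace a : R[i] := xget 0 (has_trace a).

End CompactOperatorAlgebra.

HB.mixin Record CompleteNormedModule_isHilbertKModule (R : realType)
    (H : hilbertType R) E of CompleteNormedModule R[i] E := {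
  kact : compact_op H -> E -> E;
  kactDr : forall a x y, kact a (x + y) = kact a x + kact a y;
  kactDl : forall a b x, kact (a + b) x = kact a x + kact b x;
  kactZr : forall c a x, kact a (c *: x) = c *: kact a x;
  kactZl : forall c a x, kact (c *: a) x = c *: kact a x;
  kactA : forall a b x, kact (cop_mul a b) x = kact a (kact b x);
  kdot : E -> E -> compact_op H;
  kdotDl : forall x y z, kdot (x + y) z = kdot x z + kdot y z;
  kdotZl : forall c x y, kdot (c *: x) y = c *: kdot x y;
  kdot_act : forall a x y, kdot (kact a x) y = cop_mul a (kdot x y);
  kdot_adjoint : forall x y, cop_adjoint (kdot x y) (kdot y x);
  kdot_ge0 : forall x u, 0 <= hdot (kdot x x u) u;
  (* this also gives definiteness *)
  kdot_norm : forall x, `|x| ^+ 2 = (cop_norm (kdot x x))%:C%C }.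

#[short(type="hilbertKModType")]
HB.structure Definition HilbertKModule (R : realType) (H : hilbertType R) :=
  { E of CompleteNormedModule_isHilbertKModule R H E & CompleteNormedModule R[i] E }.

(* The data shared by a Hilbert K(H)-module ([coef] = K(H)) and by a complex
   Hilbert space ([coef] = R[i]), from which closed operators, their adjoints
   and the gap metric are defined. *)
Record ipModule (R : realType) := IPModule {
  carrier :> lmodType R[i];
  coef : zmodType;
  coef_norm : coef -> R;
  act : coef -> carrier -> carrier;
  ip : carrier -> carrier -> coef }.

Definition ip_sum (R : realType) (V : ipModule R) : ipModule R :=
  @IPModule R (V * V)%type (coef V) (@coef_norm R V)
    (fun a z => (act a z.1, act a z.2))
    (fun z w => ip z.1 w.1 + ip z.2 w.2).

Section IPModuleTopology.
Context {R : realType} (V : ipModule R).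

Definition ip_norm (x : V) : R := Num.sqrt (coef_norm (ip x x)).

Definition ip_dense (D : set V) :=
  forall x (eps : R), 0 < eps -> exists2 y, D y & ip_norm (x - y) < eps.

Definition ip_closed (G : set V) := forall x,
  (forall eps : R, 0 < eps -> exists2 y, G y & ip_norm (x - y) < eps) -> G x.

Definition submodule (G : set V) :=
  [/\ G 0, (forall x y, G x -> G y -> G (x + y)),
      (forall c x, G x -> G (c *: x)) & (forall a x, G x -> G (act a x))].

Definition ip_opnorm (T : V -> V) : R :=
  sup [set ip_norm (T x) | x in [set x | ip_norm x <= 1]].

Definition is_orthoproj (G : set V) (P : V -> V) :=
  forall x, G (P x) /\ forall y, G y -> ip (x - P x) y = 0.

Definition orthoproj (G : set V) : V -> V := xget (fun=> 0) (is_orthoproj G).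

End IPModuleTopology.

(* Partial operators V -> V, identified with their graphs. *)
Definition graph_op (R : realType) (V : ipModule R) := set (V * V).

Section Operators.
Context {R : realType} {V : ipModule R}.
Implicit Types t s : graph_op V.

Definition dom t : set V := [set x | exists y, t (x, y)].

(* The sets R(E) and R(E_e); linearity of the operator (and Dom(t) being a
   submodule) is linearity of its graph. *)
Definition closed_op t :=
  [/\ (forall x y z, t (x, y) -> t (x, z) -> y = z),
      submodule (V := ip_sum V) t,
      ip_dense (dom t) &
      ip_closed (V := ip_sum V) t].

Definition op_adjoint t : graph_op V :=
  [set yz | forall x tx, t (x, tx) -> ip tx yz.1 = ip x yz.2].

Definition op_scale (c : R[i]) t : graph_op V :=
  [set xy | exists2 y, t (xy.1, y) & xy.2 = c *: y].

Definition op_add t s : graph_op V :=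
  [set xy | exists y z, [/\ t (xy.1, y), s (xy.1, z) & xy.2 = y + z]].

Definition op_comp t s : graph_op V :=
  [set xz | exists2 y, s (xz.1, y) & t (y, xz.2)].

Definition gap t s : R :=
  ip_opnorm (fun z : ip_sum V =>
    orthoproj (V := ip_sum V) t z - orthoproj (V := ip_sum V) s z).

End Operators.

Definition kmodule (R : realType) (H : hilbertType R) (E : hilbertKModType H)
  : ipModule R :=
  @IPModule R E (compact_op H) cop_norm kact kdot.

Section Corner.
Context {R : realType} {H : hilbertType R} (E : hilbertKModType H).
Variable e : compact_op H.

Definition corner_pred : {pred E} := fun y => `[< exists x, y = kact e x >].

Lemma corner_submod : GRing.submod_closed corner_pred.
Proof.
split=> [|c _ _ /asboolP[x ->] /asboolP[y ->]]; apply/asboolP.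
  by exists 0; have := kactZr 0 e (0 : E); rewrite !scale0r => ->.
by exists (c *: x + y); rewrite kactDr kactZr.
Qed.

HB.instance Definition _ :=
  GRing.isSubmodClosed.Build R[i] E corner_pred
    (GRing.submod_closed_semi corner_submod).

Record corner := Corner { corner_val :> E; _ : corner_val \in corner_pred }.

HB.instance Definition _ := [isSub for corner_val].
HB.instance Definition _ := [Choice of corner by <:].
HB.instance Definition _ := [SubChoice_isSubLmodule of corner by <:].

Definition corner_space : ipModule R :=
  @IPModule R corner R[i] (fun c => complex.Re `|c|) *:%R
    (fun x y => trace (kdot (corner_val x) (corner_val y))).

Definition psi (t : graph_op (kmodule E)) : graph_op corner_space :=
  [set xy | (exists2 x, dom t x & corner_val xy.1 = kact e x) /\
            t (corner_val xy.1, corner_val xy.2)].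

End Corner.

Arguments psi {R H E} e t.

(* Main.v *)
Require Import Defs.
From HB Require Import structures.
From mathcomp Require Import all_boot all_order all_algebra finmap.
From mathcomp Require Import all_classical all_reals all_analysis.
From mathcomp Require Import complex ring lra.

Set Implicit Arguments.
Unset Strict Implicit.
Unset Printing Implicit Defensive.
Import Order.TTheory GRing.Theory Num.Theory.
Import numFieldNormedType.Exports.
Import ComplexField.Normc.
Local Open Scope classical_set_scope.
Local Open Scope ring_scope.
Local Open Scope complex_scope.

(* A minimal projection is e = h (x) h for a unit vector h. For u in H let
   theta_u = h (x) u : w |-> <w, u> h. Then theta_u x lies in eE and
   |theta_u x|^2 = <<x, x> u, u>, so |x| is the supremum of the |theta_u x| over
   the unit ball of H, and every K(H)-linear map is controlled by its values on
   eE. As compact operators are approximated by finite-rank projections, K(H) eE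
   spans a dense submodule; hence the projection theorem of the Hilbert space eE
   passes to closed submodules of E and E (+) E, and P_{G(t)} restricts to
   P_{G(t_e)}, which gives d(t, s) = d(t_e, s_e). The inverse of psi sends r to
   the operator with graph {(x, y) : (e b x, e b y) in G(r) for all b in K(H)}. *)

(** * Complex moduli and positive semidefinite forms *)

(** The obstacle is that a closed submodule of a Hilbert C*-module need not be orthogonally
    complemented, and that the module norm satisfies neither Pythagoras nor the parallelogram law.
    Both laws do hold for each scalar form q_u(x, y) = <<x, y> u, u>, which is positive semidefinite
    but possibly degenerate; hence Hilbert space geometry is developed for such forms. Minimising
    sequences are run only where a single form gives the norm: in H, and in eE with the form q_h.
    The trace inner product of eE is the same q_h, since <x, y> = e <x, y> e = q_h(x, y) e for x, y
    in eE. Complementation of graphs serves twice: it provides the projections in the gap metric,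
    and it makes the adjoint densely defined. *)

Section ComplexModulus.
Context {R : realType}.
Implicit Types z w : R[i].

Lemma normc_ge0 z : 0 <= normc z.
Proof. by case: z => a b /=; exact: sqrtr_ge0. Qed.

Lemma normc_real (a : R) : normc a%:C = `|a|.
Proof. by rewrite /= expr0n /= addr0 sqrtr_sqr. Qed.

Lemma mul_conjc z : z * conjc z = (normc z ^+ 2)%:C.
Proof.
case: z => a b; simpc; rewrite /= sqr_sqrtr ?addr_ge0 ?sqr_ge0 //.
by rewrite [b * a]mulrC addNr -!expr2.
Qed.

Lemma complex_ge0_real z : 0 <= z -> z = (complex.Re z)%:C.
Proof. by move=> z0; rewrite RRe_real // ger0_real. Qed.

Lemma norm_normc z : `|z| = (normc z)%:C.
Proof. by case: z. Qed.

Lemma Re_le_normc z : complex.Re z <= normc z.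
Proof.
have := normc_ge_Re z; rewrite norm_normc lecR; apply: le_trans; exact: ler_norm.
Qed.

Lemma normc_small_eq0 z : (forall eps, 0 < eps -> normc z < eps) -> z = 0.
Proof.
move=> zs; apply: eq0_normc; apply/eqP; rewrite eq_le normc_ge0 andbT.
by apply/ler_addgt0Pr => eps /zs/ltW; rewrite add0r.
Qed.

End ComplexModulus.

Lemma inv_small {R : realType} (eps : R) : 0 < eps ->
  exists n0, forall n, (n0 <= n)%N -> n.+1%:R^-1 < eps.
Proof.
move=> e0; exists (Num.bound eps^-1) => n hn.
rewrite invf_plt ?posrE //; apply: lt_le_trans (archi_boundP _) _.
  by rewrite invr_ge0 ltW.
by rewrite ler_nat; apply: leq_trans hn _.
Qed.

(** The instances are the inner product of H, the form <a u, v> of a positive operator a, and the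
    forms [coef_ip] of a module; the last two need not be definite. *)
Record psd_form (R : realType) (V : lmodType R[i]) (f : V -> V -> R[i]) : Prop := {
  formDl : forall x y z, f (x + y) z = f x z + f y z;
  formZl : forall c x y, f (c *: x) y = c * f x y;
  formC : forall x y, f y x = conjc (f x y);
  form_ge0 : forall x, 0 <= f x x }.

Definition form_norm (R : realType) (V : Type) (f : V -> V -> R[i]) (x : V) : R :=
  Num.sqrt (complex.Re (f x x)).

Definition form_complete (R : realType) (V : lmodType R[i]) (f : V -> V -> R[i])
    (G : set V) := forall g : nat -> V,
  (forall n, G (g n)) ->
  (forall eps : R, 0 < eps -> exists n0, forall m n, (n0 <= m)%N -> (n0 <= n)%N ->
     form_norm f (g m - g n) < eps) ->
  exists2 l, G l & forall eps : R, 0 < eps ->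
    exists n0, forall n, (n0 <= n)%N -> form_norm f (g n - l) < eps.

Section PsdForm.
Context {R : realType} {V : lmodType R[i]} {f : V -> V -> R[i]}.
Hypothesis fP : psd_form f.
Implicit Types (x y z : V) (c : R[i]).
Local Notation N := (form_norm f).

Lemma formDr x y z : f x (y + z) = f x y + f x z.
Proof. by rewrite formC // formDl // rmorphD /= -!(formC fP). Qed.

Lemma formZr c x y : f x (c *: y) = conjc c * f x y.
Proof. by rewrite formC // formZl // rmorphM /= -!(formC fP). Qed.

Lemma form0l y : f 0 y = 0.
Proof. by rewrite -(scale0r 0) formZl // mul0r. Qed.

Lemma form0r y : f y 0 = 0.
Proof. by rewrite formC // form0l conjc0. Qed.

Lemma formNl x y : f (- x) y = - f x y.
Proof. by rewrite -scaleN1r formZl // mulN1r. Qed.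

Lemma formNr x y : f x (- y) = - f x y.
Proof. by rewrite formC // formNl rmorphN /= -(formC fP). Qed.

Lemma formBl x y z : f (x - y) z = f x z - f y z.
Proof. by rewrite formDl // formNl. Qed.

Lemma formBr x y z : f x (y - z) = f x y - f x z.
Proof. by rewrite formDr formNr. Qed.

Lemma Re_form_ge0 x : 0 <= complex.Re (f x x).
Proof. by have := form_ge0 fP x; rewrite lecE => /andP[]. Qed.

Lemma form_norm_ge0 x : 0 <= N x. Proof. exact: sqrtr_ge0. Qed.

Lemma sqr_form_norm x : N x ^+ 2 = complex.Re (f x x).
Proof. by rewrite sqr_sqrtr // Re_form_ge0. Qed.

Lemma form_self x : f x x = (N x ^+ 2)%:C.
Proof. by rewrite sqr_form_norm; apply/complex_ge0_real/form_ge0. Qed.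

Lemma form_normZ c x : N (c *: x) = normc c * N x.
Proof.
rewrite /form_norm formZl // formZr mulrA mul_conjc form_self -rmorphM /=.
by rewrite sqrtrM ?sqr_ge0 // !sqrtr_sqr !ger0_norm ?normc_ge0 ?form_norm_ge0.
Qed.

Lemma form_normN x : N (- x) = N x.
Proof. by rewrite /form_norm formNl formNr opprK. Qed.

Lemma form_norm0 : N 0 = 0.
Proof. by rewrite /form_norm form0l sqrtr0. Qed.

Lemma form_normBC x y : N (x - y) = N (y - x).
Proof. by rewrite -form_normN opprB. Qed.

Lemma sqr_form_normD x y :
  N (x + y) ^+ 2 = N x ^+ 2 + N y ^+ 2 + 2 * complex.Re (f x y).
Proof.
rewrite !sqr_form_norm formDl // !formDr (formC fP x y).
by case: (f x x) (f x y) (f y y) => [a1 b1] [a2 b2] [a3 b3] /=; ring.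
Qed.

Lemma sqr_form_normBZ x y c :
  N (x - c *: y) ^+ 2 =
  N x ^+ 2 + normc c ^+ 2 * N y ^+ 2 - 2 * complex.Re (conjc c * f x y).
Proof.
rewrite sqr_form_normD form_normN form_normZ exprMn formNr formZr.
by case: (conjc c * _) => a b /=; ring.
Qed.

(* Optimising [c] in [r <= N (x - c y) ^ 2]; Cauchy-Schwarz is [r = 0]. *)
Lemma form_gap x y (r : R) :
  (forall c, r <= N (x - c *: y) ^+ 2) ->
  normc (f x y) ^+ 2 <= (N x ^+ 2 - r) * N y ^+ 2.
Proof.
move=> rc.
(* Restricting to c = s f(x, y) with s real makes conj(c) f(x, y) real and leaves a quadratic
   polynomial in s. *)
have key (s : R) :
    r <= N x ^+ 2 + s ^+ 2 * normc (f x y) ^+ 2 * N y ^+ 2 - 2 * s * normc (f x y) ^+ 2.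
  have := rc (s%:C * f x y); rewrite sqr_form_normBZ.
  have -> : conjc (s%:C * f x y) = s%:C * conjc (f x y) by case: (f x y) => a b; simpc.
  rewrite -mulrA.
  rewrite [conjc _ * _]mulrC mul_conjc -rmorphM /= normcM normc_real exprMn.
  rewrite real_normK ?num_real //.
  by rewrite !mulrA.
(* If N y = 0 the polynomial is affine with slope -2 |f(x, y)|^2; were the slope nonzero, the s
   below would give it the value r - 1. *)
have [Ny|Ny] := eqVneq (N y ^+ 2) 0.
  rewrite Ny mulr0 leNgt; apply/negP => fxy0.
  have := key ((N x ^+ 2 - r + 1) / (2 * normc (f x y) ^+ 2)).
  have -> : 2 * ((N x ^+ 2 - r + 1) / (2 * normc (f x y) ^+ 2)) * normc (f x y) ^+ 2
    = N x ^+ 2 - r + 1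
    by field; apply: contraTneq fxy0 => ->; rewrite expr0n ltxx.
  by rewrite Ny mulr0 addr0; lra.
have {}Ny : 0 < N y ^+ 2 by rewrite lt_def Ny sqr_ge0.
(* The minimum of the polynomial is at s = 1 / N(y)^2. *)
have h := key (N y ^+ 2)^-1.
have {}h : r <= N x ^+ 2 - (normc (f x y) ^+ 2) / N y ^+ 2.
  suff <- : N x ^+ 2 + (N y ^+ 2)^-1 ^+ 2 * normc (f x y) ^+ 2 * N y ^+ 2 -
    2 * (N y ^+ 2)^-1 * normc (f x y) ^+ 2 = N x ^+ 2 - (normc (f x y) ^+ 2) / N y ^+ 2 by [].
  by field; apply: contraTneq Ny => ->; rewrite expr0n ltxx.
rewrite -ler_pdivrMr //.
by lra.
Qed.

Lemma form_CS x y : normc (f x y) <= N x * N y.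
Proof.
rewrite -(@ler_pXn2r _ 2%N) ?nnegrE ?mulr_ge0 ?form_norm_ge0 ?normc_ge0 //.
rewrite exprMn; have := @form_gap x y 0; rewrite subr0; apply => c; exact: sqr_ge0.
Qed.

Lemma form_normD x y : N (x + y) <= N x + N y.
Proof.
rewrite -(@ler_pXn2r _ 2%N) ?nnegrE ?addr_ge0 ?form_norm_ge0 //.
rewrite sqr_form_normD sqrrD.
have := le_trans (Re_le_normc (f x y)) (form_CS x y); lra.
Qed.

Lemma form_norm0P x y : N x = 0 -> f x y = 0.
Proof.
move=> Nx; apply: eq0_normc; apply/eqP; rewrite eq_le normc_ge0 andbT.
by have := form_CS x y; rewrite Nx mul0r.
Qed.

Lemma form_parallelogram x y :
  N (x + y) ^+ 2 + N (x - y) ^+ 2 = 2 * N x ^+ 2 + 2 * N y ^+ 2.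
Proof.
rewrite !sqr_form_normD form_normN formNr.
by case: (f x y) => a b /=; ring.
Qed.

(* [f] may be degenerate: only the restriction of its seminorm to [G] has to
   be complete, so [G] plays the role of a Hilbert space inside [V]. *)
Lemma form_projection (G : set V) :
  G 0 -> (forall x y, G x -> G y -> G (x + y)) ->
  (forall c x, G x -> G (c *: x)) -> form_complete f G ->
  forall x, exists2 g, G g & forall y, G y -> f (x - g) y = 0.
Proof.
move=> G0 GD GZ Gc x.
pose D := [set N (x - g) ^+ 2 | g in G]; pose d := inf D.
have hD : has_inf D.
  by split; [exists (N (x - 0) ^+ 2), 0|exists 0 => _ [g _ <-]; exact: sqr_ge0].
have dle g : G g -> d <= N (x - g) ^+ 2.
  by move=> Gg; apply: ge_inf; [exact: hD.2|exists g].
have [g gP] : {g : nat -> V & forall n, G (g n) /\ N (x - g n) ^+ 2 < d + n.+1%:R^-1}.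
  apply: (@boolp.choice _ _ (fun n g => G g /\ N (x - g) ^+ 2 < d + n.+1%:R^-1)) => n.
  have [|_ [y Gy <-] yd] := @inf_adherent _ D n.+1%:R^-1 _ hD; first by rewrite invr_gt0.
  by exists y.
have Gg n : G (g n) by have [] := gP n.
(* Parallelogram law: the midpoint of g m and g n lies in G, so its squared distance to x is at
   least d. *)
have dd m n : N (g m - g n) ^+ 2 <= 2 * m.+1%:R^-1 + 2 * n.+1%:R^-1.
  have := form_parallelogram (x - g m) (x - g n).
  have -> : x - g m - (x - g n) = g n - g m by rewrite opprB addrC addrA subrK.
  have -> : x - g m + (x - g n) = 2%:R *: (x - 2^-1 *: (g m + g n)).
    rewrite scalerBr scalerA divff ?pnatr_eq0 // scale1r scaler_nat mulr2n.
    by rewrite opprD addrACA.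
  rewrite form_normZ form_normBC exprMn.
  have -> : normc (2%:R : R[i]) = 2%:R
    by rewrite -(rmorph_nat (real_complex R)) normc_real ger0_norm.
  have := dle _ (GZ 2^-1 _ (GD _ _ (Gg m) (Gg n))).
  have [_] := gP m; have [_] := gP n; rewrite expr2.
  move: (m.+1%:R^-1) (n.+1%:R^-1) => a b; lra.
have [|l Gl lP] := Gc g Gg.
  move=> eps e0;
  have [n0 n0P] := @inv_small _ (eps ^+ 2 / 4) ltac:(by rewrite divr_gt0 ?exprn_gt0).
  exists n0 => m n /n0P hm /n0P hn.
  rewrite -(@ltr_pXn2r _ 2%N) ?nnegrE ?form_norm_ge0 ?ltW //.
  have := dd m n; move: hm hn; move: (m.+1%:R^-1) (n.+1%:R^-1) => a b; lra.
exists l => // y Gy; apply: normc_small_eq0 => eps e0.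
pose M := N y + 1.
have M0 : 0 < M by rewrite /M ltr_wpDl ?form_norm_ge0.
pose del := eps / (2 * M).
have del0 : 0 < del by rewrite divr_gt0 // mulr_gt0.
have [n1 n1P] := lP _ del0.
have [n2 n2P] := @inv_small _ (del ^+ 2) ltac:(by rewrite exprn_gt0).
pose n := maxn n1 n2.
have {}n1P := n1P n (leq_maxl _ _); have {}n2P := n2P n (leq_maxr _ _).
(* The first term is almost orthogonal to y by [form_gap] with r = d, the second is small by
   Cauchy-Schwarz. Each contributes at most del * N y, and M > N y makes the total strictly less
   than eps. *)
have -> : x - l = (x - g n) + (g n - l) by rewrite addrA subrK.
rewrite formDl //; apply: le_lt_trans (le_normcD _ _) _.
have h1 : normc (f (g n - l) y) <= del * N y.
  by apply: le_trans (form_CS _ _) _; rewrite ler_wpM2r ?form_norm_ge0 // ltW.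
have h2 : normc (f (x - g n) y) <= del * N y.
  rewrite -(@ler_pXn2r _ 2%N) ?nnegrE ?(mulr_ge0 (ltW del0)) ?form_norm_ge0 ?normc_ge0 //.
  rewrite exprMn.
  apply: le_trans (@form_gap _ _ d _) _ => [c|].
    by rewrite -addrA -opprD; apply: dle; apply: GD => //; apply: GZ.
  rewrite ler_wpM2r ?sqr_ge0 //.
  have [_] := gP n; move: n2P; move: (n.+1%:R^-1) => a; lra.
apply: le_lt_trans (lerD h2 h1) _.
have -> : eps = 2 * (del * M) by rewrite /del; field; rewrite gt_eqF.
by rewrite -mulrDr [2 * _]mulrCA ltr_pM2l // /M; have := form_norm_ge0 y; lra.
Qed.

End PsdForm.

Lemma complete_normed_seq {R : realType} (W : completeNormedModType R[i]) (g : nat -> W) :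
  (forall eps : R, 0 < eps -> exists n0, forall m n, (n0 <= m)%N -> (n0 <= n)%N ->
     complex.Re `|g m - g n| < eps) ->
  exists l, forall eps : R, 0 < eps -> exists n0, forall n, (n0 <= n)%N ->
     complex.Re `|g n - l| < eps.
Proof.
have norm_lt (x : W) (r : R) : (`|x| < r%:C) = (complex.Re `|x| < r).
  by rewrite (complex_ge0_real (normr_ge0 x)) ltcR.
move=> gc; have : cauchy (g @ \oo).
  apply/cauchy_exP => eps eps0; have epsE := complex_ge0_real (ltW eps0).
  move: eps0; rewrite epsE; move: (complex.Re eps) => e.
  rewrite -(rmorph0 (real_complex R)) ltcR => eps0.
  have [n0 n0P] := gc _ eps0; exists (g n0); exists n0 => // n /= n0n.
  by rewrite -ball_normE /= norm_lt n0P.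
move/cauchy_cvg => gl; exists (lim (g @ \oo)) => eps eps0.
have /cvgrPdist_lt /(_ eps%:C) := gl; rewrite -(rmorph0 (real_complex R)) ltcR.
move=> /(_ eps0)[n0 _ n0P]; exists n0 => n n0n.
by rewrite -norm_lt distrC; apply: n0P.
Qed.

(** * Compact operators on a Hilbert space *)

Section HilbertSpace.
Context {R : realType} {H : hilbertType R}.
Implicit Types (u v w : H) (a b : compact_op H).
Local Notation N := (form_norm (@hdot R H)).

Lemma hdot_psd : psd_form (@hdot R H).
Proof.
split; [exact: hdotDl|exact: hdotZl|exact: hdotC|].
by move=> x; rewrite -hdot_norm exprn_ge0.
Qed.
Local Notation hP := hdot_psd.

Lemma norm_form_norm u : `|u| = (N u)%:C.
Proof.
apply/eqP; rewrite -(@eqrXn2 _ 2%N) //; last by rewrite ler0c form_norm_ge0.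
by rewrite hdot_norm (form_self hP) rmorphXn.
Qed.

Lemma Re_norm_form_norm u : complex.Re `|u| = N u.
Proof. by rewrite norm_form_norm. Qed.

Lemma form_norm_eq0 u : N u = 0 -> u = 0.
Proof. by move=> Nu; apply/normr0_eq0; rewrite norm_form_norm Nu. Qed.

Lemma hdot_eq0 u : hdot u u = 0 -> u = 0.
Proof. by move=> u0; apply: form_norm_eq0; rewrite /form_norm u0 sqrtr0. Qed.

Lemma normalize u : u != 0 -> N ((N u)^-1%:C *: u) = 1.
Proof.
move=> u0; rewrite (form_normZ hP) normc_real ger0_norm ?invr_ge0 ?form_norm_ge0 //.
by rewrite mulVf //; apply: contraNneq u0 => /form_norm_eq0 ->.
Qed.

Lemma hilbert_complete (g : nat -> H) :
  (forall eps : R, 0 < eps -> exists n0, forall m n, (n0 <= m)%N -> (n0 <= n)%N ->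
     N (g m - g n) < eps) ->
  exists l, forall eps : R, 0 < eps -> exists n0, forall n, (n0 <= n)%N ->
     N (g n - l) < eps.
Proof.
move=> gc; have [|l lP] := @complete_normed_seq R H g.
  move=> eps /gc[n0 n0P]; exists n0 => m n hm hn.
  by rewrite Re_norm_form_norm n0P.
exists l => eps /lP[n0 n0P]; exists n0 => n /n0P.
by rewrite Re_norm_form_norm.
Qed.

Lemma copD a b u : (a + b) u = a u + b u. Proof. by []. Qed.
Lemma copZ (c : R[i]) a u : (c *: a) u = c *: a u. Proof. by []. Qed.
Lemma cop0 u : (0 : compact_op H) u = 0. Proof. by []. Qed.
Lemma copN a u : (- a) u = - a u. Proof. by []. Qed.
Lemma copB a b u : (a - b) u = a u - b u. Proof. by []. Qed.
Lemma cop_mulE a b u : cop_mul a b u = a (b u). Proof. by []. Qed.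

Lemma cop_ext a b : (forall u, a u = b u) -> a = b.
Proof. by move=> ab; apply/val_inj/funext. Qed.

Lemma cop_linear a : linear a.
Proof. by have /asboolP[] := valP a. Qed.

Lemma cop_opD a u v : a (u + v) = a u + a v.
Proof. by have := cop_linear a 1 u v; rewrite !scale1r. Qed.

Lemma cop_opZ a (c : R[i]) u : a (c *: u) = c *: a u.
Proof.
have a0 : a 0 = 0.
  have := cop_linear a 1 0 0; rewrite !scale1r addr0 => /eqP.
  by rewrite -subr_eq0 opprD addrA subrr sub0r oppr_eq0 => /eqP.
by have := cop_linear a c u 0; rewrite !addr0 a0 addr0.
Qed.

Lemma cop_op0 a : a 0 = 0.
Proof. by rewrite -[X in a X](scale0r (0 : H)) cop_opZ scale0r. Qed.

Lemma cop_bounded a : exists M : R, forall u, N (a u) <= M * N u.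
Proof.
have ca := compact_linear_continuous (valP a).
pose f := GRing.isLinear.Build _ _ _ _ (val a) (cop_linear a).
pose fL : {linear H -> H} := HB.pack (val a) f.
have /linear_boundedP/pinfty_ex_gt0[M M0 aM] :=
  @continuous_linear_bounded _ _ _ 0 fL (ca 0).
exists (complex.Re M) => u; have := aM u.
rewrite !norm_form_norm (complex_ge0_real (ltW M0)) -rmorphM lecR; exact.
Qed.

Let cop_has_sup a : has_sup [set complex.Re `|a u| | u in [set u | `|u| <= 1]].
Proof.
split; first by exists (complex.Re `|a 0|), 0 => //=; rewrite normr0.
have [M aM] := cop_bounded a; exists `|M| => _ [u /= u1 <-].
rewrite Re_norm_form_norm; apply: le_trans (aM u) _.
move: u1; rewrite norm_form_norm -(rmorph1 (real_complex R)) lecR => u1.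
apply: (@le_trans _ _ (`|M| * N u)).
  by rewrite ler_wpM2r ?form_norm_ge0 ?ler_norm.
by rewrite ler_piMr.
Qed.

Lemma cop_norm_ub a u : N u <= 1 -> N (a u) <= cop_norm a.
Proof.
move=> u1; apply: ub_le_sup; first exact: (cop_has_sup a).2.
exists u; last by rewrite Re_norm_form_norm.
by rewrite /= norm_form_norm -(rmorph1 (real_complex R)) lecR.
Qed.

Lemma cop_norm_lub a (c : R) : (forall u, N u <= 1 -> N (a u) <= c) -> cop_norm a <= c.
Proof.
move=> ac; apply: ge_sup; first exact: (cop_has_sup a).1.
move=> _ [u /= u1 <-]; rewrite Re_norm_form_norm; apply: ac.
by move: u1; rewrite norm_form_norm -(rmorph1 (real_complex R)) lecR.
Qed.

Lemma cop_norm_ge0 a : 0 <= cop_norm a.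
Proof.
by apply: le_trans (cop_norm_ub a (u := 0) _); rewrite ?form_norm_ge0 // (form_norm0 hP).
Qed.

Lemma cop_normP a u : N (a u) <= cop_norm a * N u.
Proof.
have [->|u0] := eqVneq u 0; first by rewrite cop_op0 (form_norm0 hP) mulr0.
have Nu : 0 < N u.
  by rewrite lt_def form_norm_ge0 andbT; apply: contraNneq u0 => /form_norm_eq0 ->.
have := cop_norm_ub a (u := (N u)^-1%:C *: u); rewrite (normalize u0) => /(_ (lexx _)).
rewrite cop_opZ (form_normZ hP) normc_real ger0_norm ?invr_ge0 ?(ltW Nu) //.
by rewrite mulrC ler_pdivrMr.
Qed.

Lemma cop_norm_mul a b : cop_norm (cop_mul a b) <= cop_norm a * cop_norm b.
Proof.
apply: cop_norm_lub => u u1; rewrite cop_mulE; apply: le_trans (cop_normP _ _) _.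
by rewrite ler_wpM2l ?cop_norm_ge0 // cop_norm_ub.
Qed.

Lemma cop_adjointC a b : cop_adjoint a b -> cop_adjoint b a.
Proof. by move=> ab u v; rewrite hdotC -ab -hdotC. Qed.

(** On the unit ball |c u|^2 = <u, d (c u)> <= |d| |c u|; dividing by |c u| gives one inequality,
    and adjointness is symmetric. *)
Lemma cop_norm_adjoint a b : cop_adjoint a b -> cop_norm a = cop_norm b.
Proof.
suff le (c d : compact_op H) : cop_adjoint c d -> cop_norm c <= cop_norm d.
  by move=> ab; apply/eqP; rewrite eq_le !le // => u v; apply: cop_adjointC.
move=> cd; apply: cop_norm_lub => u u1.
have [|cu] := ltrP 0 (N (c u)); last by apply: le_trans cu (cop_norm_ge0 d).
move=> cu; rewrite -(ler_pM2r cu) -expr2 sqr_form_norm ?cd //; last exact: hP.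
apply: le_trans (Re_le_normc _) _; apply: le_trans (form_CS hP _ _) _.
apply: le_trans (cop_normP d (c u)).
by rewrite ler_piMl ?form_norm_ge0.
Qed.

(* Cauchy-Schwarz for the form [<a u, v>] gives
   |a u|^4 <= <a u, u> <a (a u), a u> <= c |u|^2 c |a u|^2. *)
Lemma cop_norm_positive a (c : R) : cop_adjoint a a ->
  (forall u, 0 <= hdot (a u) u) ->
  (forall u, N u <= 1 -> complex.Re (hdot (a u) u) <= c) -> cop_norm a <= c.
Proof.
move=> aa a0 ac.
pose g u v := hdot (a u) v.
have gP : psd_form g.
  split=> [x y z|k x y|x y|//]; rewrite /g ?cop_opD ?hdotDl ?cop_opZ ?hdotZl //.
  by rewrite aa hdotC.
have c0 : 0 <= c.
  by apply: le_trans (ac 0 _); rewrite ?(form_norm0 hP) // cop_op0 (form0r hP).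
have gc u : form_norm g u ^+ 2 <= c * N u ^+ 2.
  have [->|u0] := eqVneq u 0; first
    by rewrite (form_norm0 gP) (form_norm0 hP) expr0n /= mulr0.
  have Nu : 0 < N u.
    by rewrite lt_def form_norm_ge0 andbT; apply: contraNneq u0 => /form_norm_eq0 ->.
  have := ac ((N u)^-1%:C *: u); rewrite (normalize u0) => /(_ (lexx _)).
  rewrite -/(g _ _) -(sqr_form_norm gP) (form_normZ gP) normc_real.
  rewrite ger0_norm ?invr_ge0 ?(ltW Nu) // exprMn exprVn mulrC.
  by rewrite ler_pdivrMr // exprn_gt0.
apply: cop_norm_lub => u u1.
have [|au0] := ltrP 0 (N (a u)); last exact: le_trans au0 c0.
move=> au0; rewrite -(@ler_pXn2r _ 2%N) ?nnegrE ?form_norm_ge0 //.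
have h := form_CS gP u (a u).
rewrite {1}/g (form_self hP) normc_real ger0_norm ?sqr_ge0 // in h.
have {}h : (N (a u) ^+ 2) ^+ 2 <= (c * N u ^+ 2) * (c * N (a u) ^+ 2).
  apply: (@le_trans _ _ (form_norm g u ^+ 2 * form_norm g (a u) ^+ 2)).
    by rewrite -exprMn ler_pXn2r ?nnegrE ?mulr_ge0 ?sqr_ge0 ?form_norm_ge0.
  by apply: ler_pM; rewrite ?sqr_ge0.
have au2 : 0 < N (a u) ^+ 2 by rewrite exprn_gt0.
rewrite -(ler_pM2r au2) -expr2; apply: le_trans h _.
have -> : c * N u ^+ 2 * (c * N (a u) ^+ 2) = N u ^+ 2 * (c ^+ 2 * N (a u) ^+ 2) by ring.
apply: ler_piMl; first by rewrite mulr_ge0 ?sqr_ge0.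
by rewrite expr_le1 // form_norm_ge0.
Qed.

(** Complex scalars are essential: pairing u with a u gives <a u, a u> + <a (a u), u> = 0, pairing
    it with i a u gives the same equation with a minus sign. A rotation by a right angle refutes the
    real analogue. *)
Lemma polarization a : (forall u, hdot (a u) u = 0) -> a = 0.
Proof.
move=> a0; apply: cop_ext => u; rewrite cop0; apply: hdot_eq0.
have h x y : hdot (a x) y + hdot (a y) x = 0.
  have := a0 (x + y); rewrite cop_opD !(formDl hP) !(formDr hP) !a0 add0r addr0.
  by [].
have := h u (a u); have := h u ('i%C *: a u).
rewrite cop_opZ hdotZl (formZr hP); move: (hdot (a u) (a u)) (hdot (a (a u)) u).
move=> [x1 y1] [x2 y2]; simpc => -[? ?] [? ?]; apply/eqP; rewrite eq_complex /=.
by apply/andP; split; apply/eqP; lra.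
Qed.

Lemma total_bound a (eps : R) : 0 < eps ->
  exists s : seq H, forall u, N u <= 1 -> exists2 z, z \in s & N (a u - z) < eps.
Proof.
move=> eps0; have /asboolP[_] := valP a; rewrite precompactE compact_cover => ca.
have [||D _ AD] := ca H setT (fun x => ball x eps%:C).
- by move=> x _; apply: ball_open; rewrite -(rmorph0 (real_complex R)) ltcR.
- by move=> x _; exists x => //; apply: ballxx; rewrite -(rmorph0 (real_complex R)) ltcR.
exists (enum_fset D) => u u1; have [|z zD] := AD (a u).
  apply: subset_closure; exists u => //=.
  by rewrite norm_form_norm -(rmorph1 (real_complex R)) lecR.
rewrite -ball_normE /= norm_form_norm ltcR => h; exists z => //.
by rewrite (form_normBC hP).
Qed.

End HilbertSpace.

(** * Orthonormal bases and rank-one operators *)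

Section OrthonormalBasis.
Context {R : realType} {H : hilbertType R}.
Implicit Types (u v w x : H) (F : {fset H}).
Local Notation N := (form_norm (@hdot R H)).
Local Notation hP := (@hdot_psd R H).

(** [has_trace] quantifies over all orthonormal bases, so a trace is unique only because one exists.
    A nonzero vector orthogonal to a maximal orthonormal family could be normalised and added to
    it. *)
Lemma orthonormal_basis_exists : exists B : set H, orthonormal_basis B.
Proof.
pose P := [set B : set H | (forall b, B b -> hdot b b = 1) /\
   (forall b b', B b -> B b' -> b <> b' -> hdot b b' = 0)].
have [|B [[B1 B2] Bmax]] := @Zorn_bigcup H P.
  move=> F FP Ftot; split=> [b [X FX Xb]|b b' [X FX Xb] [Y FY Yb']].
    by have [h _] := FP X FX; apply: h.
  by case: (Ftot X Y FX FY) => [XY|YX];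
     [have [_ h] := FP Y FY|have [_ h] := FP X FX]; apply: h => //; [apply: XY|apply: YX].
exists B; split=> // x xB; apply: contrapT => /eqP x0.
pose y := (N x)^-1%:C *: x.
have yB b : B b -> hdot y b = 0 by move=> Bb; rewrite hdotZl xB // mulr0.
have yy : hdot y y = 1 by rewrite (form_self hP) (normalize x0) expr1n.
apply: (Bmax (B `|` [set y])); first split.
- by move=> b Bb; left.
- move=> BB; have By : B y by apply: BB; right.
  by have := yB y By; rewrite yy => /eqP; rewrite oner_eq0.
- split=> [b [/B1 //|->//]|b b' [Bb|->] [Bb'|->] bb'].
  + exact: B2.
  + by rewrite hdotC yB // conjc0.
  + by rewrite yB.
  + by case: bb'.
Qed.

(** For F inside an orthonormal family, the orthogonal projection onto the span of F. *)
Definition partial_expansion F x : H := \sum_(b <- F) hdot x b *: b.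

Section Basis.
Variables (B : set H) (BP : orthonormal_basis B).

Lemma expansionD F x y :
  partial_expansion F (x + y) = partial_expansion F x + partial_expansion F y.
Proof. by rewrite -big_split; apply: eq_bigr => b _; rewrite hdotDl scalerDl. Qed.

Lemma expansionZ F (c : R[i]) x :
  partial_expansion F (c *: x) = c *: partial_expansion F x.
Proof. by rewrite scaler_sumr; apply: eq_bigr => b _; rewrite hdotZl scalerA. Qed.

Lemma expansionB F x y :
  partial_expansion F (x - y) = partial_expansion F x - partial_expansion F y.
Proof. by rewrite -scaleN1r expansionD expansionZ scaleN1r. Qed.

Lemma hdot_suml (I : Type) (r : seq I) (g : I -> H) y :
  hdot (\sum_(i <- r) g i) y = \sum_(i <- r) hdot (g i) y.
Proof.
elim/big_rec2 : _ => [|i a b _ <-]; first by rewrite (form0l hP).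
by rewrite hdotDl.
Qed.

Lemma hdot_sumr (I : Type) (r : seq I) (g : I -> H) y :
  hdot y (\sum_(i <- r) g i) = \sum_(i <- r) hdot y (g i).
Proof.
elim/big_rec2 : _ => [|i a b _ <-]; first by rewrite (form0r hP).
by rewrite (formDr hP).
Qed.

Lemma hdot_expansion_basis F x b : [set` F] `<=` B -> b \in F ->
  hdot (partial_expansion F x) b = hdot x b.
Proof.
move=> FB bF; have [B1 B2 _] := BP.
rewrite hdot_suml (big_fsetD1 b bF) /= hdotZl (B1 b (FB b bF)) mulr1.
rewrite big_seq big1 ?addr0 // => b' /fsetD1P[/eqP bb' b'F].
by rewrite hdotZl (B2 b' b) ?mulr0 //; apply: FB.
Qed.

(** Bessel's inequality with its defect; in particular x - P_F x is never longer than x, uniformly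
    in F. *)
Lemma sqr_norm_expansion F x : [set` F] `<=` B ->
  N (x - partial_expansion F x) ^+ 2 = N x ^+ 2 - \sum_(b <- F) normc (hdot x b) ^+ 2.
Proof.
move=> FB; apply: complexI; rewrite -(form_self hP) (formBr hP).
have -> : hdot (x - partial_expansion F x) (partial_expansion F x) = 0.
  rewrite hdot_sumr big_seq big1 // => b bF.
  by rewrite (formZr hP) (formBl hP) hdot_expansion_basis // subrr mulr0.
rewrite subr0 (formBl hP) (form_self hP) rmorphB rmorph_sum; congr (_ - _).
by rewrite hdot_suml; apply: eq_bigr => b _; rewrite hdotZl (hdotC x b) mul_conjc.
Qed.

Lemma expansion_basis F b : [set` F] `<=` B -> b \in F -> partial_expansion F b = b.
Proof.
move=> FB bF; have [B1 B2 _] := BP.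
rewrite /partial_expansion (big_fsetD1 b bF) /= (B1 b (FB b bF)) scale1r.
rewrite big_seq big1 ?addr0 // => b' /fsetD1P[/eqP bb' b'F].
by rewrite (B2 b b') ?scale0r //; [exact: FB|exact: FB|exact/nesym].
Qed.

(* The set of vectors satisfying Parseval's identity is a closed subspace
   containing [B]; a vector orthogonal to it vanishes since [B] is maximal. *)
Lemma parseval x (eps : R) : 0 < eps ->
  exists2 F0 : {fset H}, [set` F0] `<=` B &
    forall F : {fset H}, [set` F0] `<=` [set` F] -> [set` F] `<=` B ->
      N (x - partial_expansion F x) < eps.
Proof.
pose G := [set x | forall eps : R, 0 < eps ->
  exists2 F0 : {fset H}, [set` F0] `<=` B &
    forall F : {fset H}, [set` F0] `<=` [set` F] -> [set` F] `<=` B ->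
      N (x - partial_expansion F x) < eps].
have Gadd y z : G y -> G z -> G (y + z).
  move=> Gy Gz e e0; have e20 : 0 < e / 2 by rewrite divr_gt0.
  have [F1 F1B F1P] := Gy _ e20; have [F2 F2B F2P] := Gz _ e20.
  exists (F1 `|` F2)%fset => [b /= /fsetUP[/F1B|/F2B] //|F FF FB].
  rewrite expansionD opprD addrACA; apply: le_lt_trans (form_normD hP _ _) _.
  have h1 : N (y - partial_expansion F y) < e / 2.
    by apply: F1P => // b bF; apply: FF; rewrite /= inE bF.
  have h2 : N (z - partial_expansion F z) < e / 2.
    by apply: F2P => // b bF; apply: FF; rewrite /= inE bF orbT.
  by lra.
have Gscal (c : R[i]) y : G y -> G (c *: y).
  move=> Gy e e0.
  (* The summand 1 keeps the divisor positive when c = 0. *)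
  have c1 : 0 < normc c + 1 by rewrite ltr_wpDl ?normc_ge0.
  have [F1 F1B F1P] := Gy (e / (normc c + 1)) ltac:(by rewrite divr_gt0).
  exists F1 => // F /F1P /[apply]; rewrite expansionZ -scalerBr (form_normZ hP).
  rewrite ltr_pdivlMr // => h; apply: le_lt_trans h.
  by rewrite mulrC ler_wpM2l ?form_norm_ge0 // lerDl.
have Gcl : form_complete (@hdot R H) G.
  move=> g Gg gc; have [l lP] := hilbert_complete gc; exists l => // e e0.
  have e20 : 0 < e / 2 by rewrite divr_gt0.
  have [n n0P] := lP _ e20; have [F1 F1B F1P] := Gg n _ e20.
  exists F1 => // F F1F FB; have {}n0P := n0P n (leqnn n).
  have := F1P F F1F FB.
  (* The error at l is the error at g n minus the error at g n - l, and Bessel bounds the latter by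
     N (g n - l) whatever F is. *)
  have -> : l - partial_expansion F l = (g n - partial_expansion F (g n)) -
     ((g n - l) - partial_expansion F (g n - l)).
    move: (g n) => y; have lE : l = y - (y - l) by rewrite opprB addrC subrK.
    rewrite {1 2}lE; move: (y - l) => d; rewrite expansionB !opprB [_ d - _]addrC addrACA.
    by rewrite addrC; congr (_ + _); rewrite addrC.
  move=> h; apply: le_lt_trans (form_normD hP _ _) _; rewrite (form_normN hP).
  have : N (g n - l - partial_expansion F (g n - l)) <= N (g n - l).
    rewrite -(@ler_pXn2r _ 2%N) ?nnegrE ?form_norm_ge0 //.
    by rewrite sqr_norm_expansion // gerBl sumr_ge0 // => b _; rewrite sqr_ge0.
  by lra.
have G0 : G 0.
  move=> e e0; exists fset0 => // F _ _.
  rewrite /partial_expansion big1 ?subrr ?(form_norm0 hP) // => b _.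
  by rewrite (form0l hP) scale0r.
have [g Gg gP] := form_projection hP G0 Gadd Gscal Gcl x.
suff -> : x = g by exact: Gg.
have [B1 B2 B3] := BP.
apply/eqP; rewrite -subr_eq0; apply/eqP; apply: B3 => b Bb; apply: gP => e e0.
exists [fset b]%fset => [c /=|F bF FB]; first by rewrite inE => /eqP ->.
rewrite expansion_basis ?subrr ?(form_norm0 hP) //.
by apply: bF; rewrite /= inE.
Qed.

End Basis.
End OrthonormalBasis.

(** * Rank-one operators, the trace, and finite-rank approximation *)

Section RankOne.
Context {R : realType} {H : hilbertType R}.
Implicit Types (u v w h : H) (a b e : compact_op H).
Local Notation N := (form_norm (@hdot R H)).
Local Notation hP := (@hdot_psd R H).

Definition projects_on e h := N h = 1 /\ forall u, e u = hdot u h *: h.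

Lemma normc_hdot_le u v : N v = 1 -> normc (hdot u v) <= N u.
Proof. by move=> v1; apply: le_trans (form_CS hP _ _) _; rewrite v1 mulr1. Qed.

Lemma norm_le1 u : (`|u| <= 1) = (N u <= 1).
Proof. by rewrite norm_form_norm -(rmorph1 (real_complex R)) lecR. Qed.

(** For a unit vector h in the range of e, the projection onto C h is nonzero and lies below e, so
    minimality identifies the two. *)
Lemma minimal_projection_rank_one e : minimal_projection e -> exists h, projects_on e h.
Proof.
move=> [[ee eadj] e0 emin].
have [u eu0] : exists u, e u != 0.
  apply: contrapT => eu; move/eqP: e0; apply; apply: cop_ext => u.
  by rewrite cop0; apply: contrapT => /eqP ?; apply: eu; exists u.
pose h := (N (e u))^-1%:C *: e u.
have h1 : N h = 1 by exact: normalize.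
have eh : e h = h by rewrite cop_opZ -cop_mulE ee.
clearbody h.
(* Compactness is inherited from e: the image of the unit ball consists of vectors c h with |c| <=
   1, which e fixes. *)
have fc : (fun w => hdot w h *: h) \in @compact_linear R H.
  have /asboolP[_ ec] := valP e; apply/asboolP; split.
    by move=> c x y; rewrite hdotDl hdotZl scalerDl scalerA.
  apply: precompact_subset ec => _ [w /= w1 <-].
  exists (hdot w h *: h); last by rewrite /= cop_opZ eh.
  rewrite /= norm_le1 (form_normZ hP) h1 mulr1.
  by apply: le_trans (normc_hdot_le _ h1) _; rewrite -norm_le1.
pose f : compact_op H := CompactOp fc.
have fE w : f w = hdot w h *: h by [].
have hh : hdot h h = 1 by rewrite (form_self hP) h1 expr1n.
have [||f0|fe] := emin f.
- split; first by apply: cop_ext => w; rewrite cop_mulE !fE hdotZl hh mulr1.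
  by move=> v w; rewrite !fE hdotZl (formZr hP) mulrC -hdotC.
- by apply: cop_ext => w; rewrite cop_mulE !fE cop_opZ eh.
- have := fE h; rewrite f0 cop0 hh scale1r => h0.
  by move: hh; rewrite -h0 (form0l hP) => /esym/eqP; rewrite oner_eq0.
- by exists h; split=> // w; rewrite -fe.
Qed.

(** The operator u (x) v, picked by choice with default 0: its compactness is proved in [rank_oneE],
    from that of a given rank-one projection. *)
Definition rank_one u v : compact_op H :=
  xget 0 [set a : compact_op H | forall w, a w = hdot w v *: u].

Section Projection.
Variables (e : compact_op H) (h : H).
Hypothesis eh : projects_on e h.

Lemma projects_on_unit : hdot h h = 1.
Proof. by rewrite (form_self hP) eh.1 expr1n. Qed.

(* The discs [{c u : |c| <= r}] are compact since [e] maps the unit ball onto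
   [{c h : |c| <= 1}]. *)
Lemma rank_oneE u v w : rank_one u v w = hdot w v *: u.
Proof.
have [h1 eE] := eh.
have rc : (fun w => hdot w v *: u) \in @compact_linear R H.
  have /asboolP[_] := valP e; rewrite precompactE => ec; apply/asboolP; split.
    by move=> c x y; rewrite hdotDl hdotZl scalerDl scalerA.
  pose M := N v + 1; have M0 : 0 < M by rewrite /M ltr_wpDl ?form_norm_ge0.
  pose phi x : H := (M%:C * hdot x h) *: u.
  have phil : linear phi.
    by move=> c x y; rewrite /phi hdotDl hdotZl mulrDr scalerDl scalerA mulrCA.
  have phic : continuous phi.
    pose g := GRing.isLinear.Build _ _ _ _ phi phil.
    pose gL : {linear H -> H} := HB.pack phi g.
    apply: (@bounded_linear_continuous _ _ _ gL).
    apply/ex_bound; exists (M * N u)%:C; apply/nbhs_normP; exists 1 => //= x.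
    rewrite /= sub0r normrN norm_form_norm -(rmorph1 (real_complex R)) ltcR => x1.
    rewrite norm_form_norm lecR /phi (form_normZ hP) normcM normc_real gtr0_norm //.
    rewrite ler_wpM2r ?form_norm_ge0 // ler_piMr ?(ltW M0) //.
    exact: le_trans (normc_hdot_le _ h1) (ltW x1).
  have := continuous_compact (continuous_subspaceT phic) ec => pc.
  have cl : closed (phi @` closure (e @` [set x | `|x| <= 1])).
    by apply: compact_closed pc; exact: norm_hausdorff.
  rewrite -(precompact_closed cl) in pc; apply: precompact_subset pc.
  (* The preimage (<x, v> / M) h is in the unit ball because |<x, v>| <= |v| < M, and e fixes it. *)
  move=> _ [x /= x1 <-]; exists ((M^-1%:C * hdot x v) *: h).
    apply: subset_closure; exists ((M^-1%:C * hdot x v) *: h); last first.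
      by rewrite /= eE hdotZl projects_on_unit mulr1.
    rewrite /= norm_le1 (form_normZ hP) h1 mulr1 normcM normc_real.
    rewrite ger0_norm ?invr_ge0 ?(ltW M0) // ler_pdivrMl // mulr1.
    apply: le_trans (form_CS hP _ _) _; rewrite norm_le1 in x1.
    apply: (@le_trans _ _ (N v)); last by rewrite /M lerDl.
    by rewrite ler_piMl ?form_norm_ge0.
  rewrite /phi hdotZl projects_on_unit mulr1 mulrA -rmorphM mulfV ?gt_eqF //.
  by rewrite rmorph1 mul1r.
have : exists a : compact_op H, forall w, a w = hdot w v *: u by exists (CompactOp rc).
by move=> ex; exact: (xgetPex 0 ex).
Qed.

Lemma projects_onE : e = rank_one h h.
Proof. by apply: cop_ext => w; rewrite rank_oneE eh.2. Qed.

Lemma projects_on_idem : cop_mul e e = e.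
Proof. by apply: cop_ext => w; rewrite cop_mulE !eh.2 hdotZl projects_on_unit mulr1. Qed.

(** The algebraic form of minimality, e K(H) e = C e. *)
Lemma compression a : cop_mul e (cop_mul a e) = hdot (a h) h *: e.
Proof.
by apply: cop_ext => w; rewrite !cop_mulE copZ !eh.2 cop_opZ hdotZl scalerA mulrC.
Qed.

(** By Parseval for h: the partial sum over F is c times the sum of the |<h, b>|^2, so it differs
    from c by c |h - P_F h|^2. *)
Lemma has_trace_scale (c : R[i]) : has_trace (c *: e) c.
Proof.
move=> B BP eps eps0; have epsE := complex_ge0_real (ltW eps0).
move: eps0; rewrite epsE; move: (complex.Re eps) => r; rewrite ltcR => r0.
have c1 : 0 < normc c + 1 by rewrite ltr_wpDl ?normc_ge0.
(* The bound 1 allows n^2 <= n for n = |h - P_F h|, so that |c| n^2 < r follows from a bound on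
   n. *)
pose d := Num.min 1 (r / (normc c + 1)).
have d0 : 0 < d by rewrite lt_min ltr01 divr_gt0.
have [F0 F0B F0P] := parseval BP h d0.
exists F0 => // F F0F FB; have := F0P F F0F FB.
have nE := sqr_norm_expansion BP h FB.
have -> : \sum_(b <- F) hdot ((c *: e) b) b - c =
    - c * (N (h - partial_expansion F h) ^+ 2)%:C.
  rewrite nE eh.1 expr1n rmorphB rmorph1 mulrBr mulr1 mulNr opprK addrC.
  congr (_ + _); rewrite rmorph_sum mulr_sumr; apply: eq_bigr => b _.
  by rewrite copZ eh.2 scalerA hdotZl -mulrA (hdotC h b) [conjc _ * _]mulrC mul_conjc.
rewrite norm_normc ltcR normcM normcN normc_real ger0_norm ?sqr_ge0 //.
set n := N _; rewrite lt_min => /andP[n1].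
rewrite ltr_pdivlMr // => nr; have n0 : 0 <= n by exact: form_norm_ge0.
apply: le_lt_trans nr; rewrite mulrC.
apply: ler_pM; rewrite ?sqr_ge0 ?normc_ge0 ?lerDl //.
by rewrite expr2 ler_piMl // ltW.
Qed.

Lemma has_trace_unique a (c d : R[i]) : has_trace a c -> has_trace a d -> c = d.
Proof.
move=> ac ad; have [B BP] := @orthonormal_basis_exists R H.
apply/eqP; rewrite -subr_eq0; apply/eqP; apply: normc_small_eq0 => r r0.
have r2 : 0 < (r / 2)%:C by rewrite ltcR divr_gt0.
have [F1 F1B F1P] := ac B BP _ r2; have [F2 F2B F2P] := ad B BP _ r2.
pose F := (F1 `|` F2)%fset.
have FB : [set` F] `<=` B by move=> b /= /fsetUP[/F1B|/F2B].
have := F1P F _ FB; have := F2P F _ FB; rewrite !norm_normc !ltcR => h2 h1.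
have {}h1 := h1 ltac:(by move=> b bF; rewrite /= inE bF).
have {}h2 := h2 ltac:(by move=> b bF; rewrite /= inE bF orbT).
move: h1 h2; set S := \sum_(b <- F) _ => h1 h2.
have -> : c - d = - (S - c) + (S - d) by rewrite opprB addrA subrK.
by apply: le_lt_trans (le_normcD _ _) _; rewrite normcN; lra.
Qed.

Lemma trace_scale (c : R[i]) : trace (c *: e) = c.
Proof.
apply: xget_unique; first exact: has_trace_scale.
by move=> d hd; apply: has_trace_unique hd (has_trace_scale c).
Qed.

Lemma cop_sumE (I : Type) (r : seq I) (g : I -> compact_op H) w :
  (\sum_(i <- r) g i) w = \sum_(i <- r) g i w.
Proof. by elim/big_rec2 : _ => [//|i x y _ <-]; rewrite copD. Qed.

(** A finite net of the image of the unit ball reduces uniform approximation to finitely many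
    vectors. Self-adjointness and the contraction property of 1 - p are what [corner_span_dense]
    needs besides. *)
Lemma finite_rank_approximation a (eps : R) : 0 < eps ->
  exists F : {fset H}, let p := \sum_(b <- F) rank_one b b in
    [/\ cop_adjoint p p, (forall u, N (u - p u) <= N u) &
        cop_norm (a - cop_mul p a) <= eps].
Proof.
move=> eps0; have [B BP] := @orthonormal_basis_exists R H.
have pE (F : {fset H}) w : (\sum_(b <- F) rank_one b b) w = partial_expansion F w.
  by rewrite cop_sumE; apply: eq_bigr => b _; rewrite rank_oneE.
have e20 : 0 < eps / 2 by rewrite divr_gt0.
have [s sP] := total_bound a e20.
have [F FB FP] : exists2 F : {fset H}, [set` F] `<=` B &
    forall z, z \in s -> N (z - partial_expansion F z) < eps / 2.
  have : exists2 F0 : {fset H}, [set` F0] `<=` B & forall F, [set` F0] `<=` [set` F] ->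
     [set` F] `<=` B -> forall z, z \in s -> N (z - partial_expansion F z) < eps / 2.
    elim: s {sP} => [|y s [F1 F1B F1P]]; first by exists fset0.
    have [F2 F2B F2P] := parseval BP y e20.
    exists (F1 `|` F2)%fset => [b /= /fsetUP[/F1B|/F2B] //|F FF FB z].
    rewrite inE => /orP[/eqP ->|zs].
      by apply: F2P => // b bF; apply: FF; rewrite /= inE bF orbT.
    by apply: F1P => // b bF; apply: FF; rewrite /= inE bF.
  by move=> [F FB FP]; exists F => // z; apply: FP.
have contr u : N (u - partial_expansion F u) <= N u.
  rewrite -(@ler_pXn2r _ 2%N) ?nnegrE ?form_norm_ge0 //.
  by rewrite (sqr_norm_expansion BP) // gerBl sumr_ge0 // => b _; rewrite sqr_ge0.
exists F; split=> [u v|u|]; [rewrite !pE|by rewrite pE|].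
  rewrite hdot_suml hdot_sumr; apply: eq_bigr => b _.
  by rewrite hdotZl (formZr hP) mulrC -hdotC mulrC.
apply: cop_norm_lub => u u1; rewrite copB cop_mulE pE.
have [z zs zu] := sP u u1.
(* Replace a u by a nearby net point z; the remainder is 1 - p applied to a u - z, hence no longer
   than a u - z. *)
have -> : a u - partial_expansion F (a u) = (z - partial_expansion F z) +
    ((a u - z) - partial_expansion F (a u - z)).
  by rewrite expansionB opprB addrACA [z + _]addrC subrK addKr.
apply: le_trans (form_normD hP _ _) _.
have := FP z zs; have := contr (a u - z); lra.
Qed.

End Projection.
End RankOne.

(** * Hilbert K(H)-modules *)

(** The scalar form q_u. For u = h it becomes the inner product of the corner, see [ip_corner]. *)
Definition coef_ip {R : realType} {H : hilbertType R} {V : Type}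
    (ip : V -> V -> compact_op H) (u : H) (x y : V) : R[i] := hdot (ip x y u) u.

Definition complete_norm {R : realType} {V : zmodType} (nrm : V -> R) :=
  forall g : nat -> V,
  (forall eps : R, 0 < eps -> exists n0, forall m n, (n0 <= m)%N -> (n0 <= n)%N ->
     nrm (g m - g n) < eps) ->
  exists l, forall eps : R, 0 < eps ->
    exists n0, forall n, (n0 <= n)%N -> nrm (g n - l) < eps.

Definition compact_ipModule {R : realType} {H : hilbertType R} {V : lmodType R[i]}
    (act : compact_op H -> V -> V) (ip : V -> V -> compact_op H) : ipModule R :=
  @IPModule R V (compact_op H) cop_norm act ip.

(* The axioms of a Hilbert K(H)-module without the bundled topology, so that
   they also apply to the direct sum [ip_sum]. *)
Record is_kmodule (R : realType) (H : hilbertType R) (V : lmodType R[i])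
    (act : compact_op H -> V -> V) (ip : V -> V -> compact_op H) : Prop := {
  kmod_actDr : forall a x y, act a (x + y) = act a x + act a y;
  kmod_actDl : forall a b x, act (a + b) x = act a x + act b x;
  kmod_actZr : forall (c : R[i]) a x, act a (c *: x) = c *: act a x;
  kmod_actZl : forall (c : R[i]) a x, act (c *: a) x = c *: act a x;
  kmod_actA : forall a b x, act (cop_mul a b) x = act a (act b x);
  kipDl : forall x y z, ip (x + y) z = ip x z + ip y z;
  kipZl : forall (c : R[i]) x y, ip (c *: x) y = c *: ip x y;
  kip_act : forall a x y, ip (act a x) y = cop_mul a (ip x y);
  kip_adjoint : forall x y, cop_adjoint (ip x y) (ip y x);
  kip_ge0 : forall x u, 0 <= hdot (ip x x u) u;
  kip_eq0 : forall x, ip x x = 0 -> x = 0;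
  kip_complete : complete_norm (@ip_norm R (compact_ipModule act ip)) }.

Section KModule.
Context {R : realType} {H : hilbertType R} {V : lmodType R[i]}.
Variables (act : compact_op H -> V -> V) (ip : V -> V -> compact_op H).
Hypothesis kP : is_kmodule act ip.
Implicit Types (x y z : V) (u v w : H) (a b : compact_op H) (c : R[i]).
Local Notation N := (form_norm (@hdot R H)).
Local Notation hP := (@hdot_psd R H).
Local Notation V' := (compact_ipModule act ip).
Local Notation knorm := (@ip_norm R V').
Local Notation q := (coef_ip ip).

Lemma coef_psd u : psd_form (q u).
Proof.
split=> [x y z|c x y|x y|x]; rewrite /coef_ip.
- by rewrite (kipDl kP) copD hdotDl.
- by rewrite (kipZl kP) copZ hdotZl.
- by rewrite (kip_adjoint kP) hdotC.
- exact: (kip_ge0 kP).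
Qed.

Lemma kip0l y : ip 0 y = 0.
Proof. by rewrite -(scale0r (0 : V)) (kipZl kP) scale0r. Qed.

Lemma kipNl x y : ip (- x) y = - ip x y.
Proof. by rewrite -scaleN1r (kipZl kP) scaleN1r. Qed.

Lemma kipBl x y z : ip (x - y) z = ip x z - ip y z.
Proof. by rewrite (kipDl kP) kipNl. Qed.

Lemma act0r a : act a 0 = 0.
Proof. by rewrite -[X in act a X](scale0r (0 : V)) (kmod_actZr kP) scale0r. Qed.

Lemma act0l x : act 0 x = 0.
Proof. by rewrite -(scale0r (0 : compact_op H)) (kmod_actZl kP) scale0r. Qed.

Lemma actNr a x : act a (- x) = - act a x.
Proof. by rewrite -scaleN1r (kmod_actZr kP) scaleN1r. Qed.

Lemma actBr a x y : act a (x - y) = act a x - act a y.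
Proof. by rewrite (kmod_actDr kP) actNr. Qed.

Lemma act_suml (I : Type) (r : seq I) (g : I -> compact_op H) x :
  act (\sum_(i <- r) g i) x = \sum_(i <- r) act (g i) x.
Proof.
by elim/big_rec2 : _ => [|i y b _ <-]; rewrite ?act0l // (kmod_actDl kP).
Qed.

(* Equalities between inner products may be read with the arguments swapped. *)
Lemma kip_flip x y z t : ip x y = ip z t -> ip y x = ip t z.
Proof.
move=> xyzt; apply: cop_ext => u; apply/eqP; rewrite -subr_eq0; apply/eqP/hdot_eq0.
set v := _ - _; rewrite (formBl hP) !(kip_adjoint kP) /v.
by rewrite xyzt subrr.
Qed.

Lemma coef_ip_le u x : N u <= 1 -> form_norm (q u) x <= knorm x.
Proof.
move=> u1; rewrite ler_sqrt ?cop_norm_ge0 //.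
apply: le_trans (Re_le_normc _) _; apply: le_trans (form_CS hP _ _) _.
apply: le_trans (cop_norm_ub _ u1); by rewrite ler_piMr ?form_norm_ge0.
Qed.

Lemma coef_ip_scale u x c : form_norm (q (c *: u)) x = normc c * form_norm (q u) x.
Proof.
rewrite /form_norm /coef_ip cop_opZ hdotZl (formZr hP) mulrA mul_conjc.
have -> (z : R[i]) : complex.Re ((normc c ^+ 2)%:C * z) = normc c ^+ 2 * complex.Re z.
  by case: z => a b /=; rewrite mul0r subr0.
by rewrite sqrtrM ?sqr_ge0 // sqrtr_sqr ger0_norm ?normc_ge0.
Qed.

Lemma coef_ip_le_norm u x : form_norm (q u) x <= knorm x * N u.
Proof.
have [->|u0] := eqVneq u 0.
  by rewrite (form_norm0 hP) mulr0 -(scale0r (0 : H)) coef_ip_scale normc0 mul0r.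
have Nu : 0 < N u.
  by rewrite lt_def form_norm_ge0 andbT; apply: contraNneq u0 => /form_norm_eq0 ->.
have := @coef_ip_le ((N u)^-1%:C *: u) x; rewrite (normalize u0) => /(_ (lexx _)).
rewrite coef_ip_scale normc_real ger0_norm ?invr_ge0 ?(ltW Nu) //.
by rewrite mulrC ler_pdivrMr.
Qed.

Lemma knorm_ge0 x : 0 <= knorm x. Proof. exact: sqrtr_ge0. Qed.

Lemma sqr_knorm x : knorm x ^+ 2 = cop_norm (ip x x).
Proof. by rewrite sqr_sqrtr // cop_norm_ge0. Qed.

(** The operator <x, x> is positive, so its norm is the supremum of its quadratic form u |-> q_u(x,
    x). *)
Lemma knorm_lub x (r : R) :
  (forall u, N u <= 1 -> form_norm (q u) x <= r) -> knorm x <= r.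
Proof.
move=> xr; have r0 : 0 <= r.
  by apply: le_trans (xr 0 _); rewrite ?form_norm_ge0 ?(form_norm0 hP).
rewrite -(@ler_pXn2r _ 2%N) ?nnegrE ?knorm_ge0 // sqr_knorm.
apply: cop_norm_positive; [exact: (kip_adjoint kP)|exact: (kip_ge0 kP)|].
move=> u /xr; rewrite -(@ler_pXn2r _ 2%N) ?nnegrE ?form_norm_ge0 //.
by rewrite (sqr_form_norm (coef_psd u)).
Qed.

Lemma knormD x y : knorm (x + y) <= knorm x + knorm y.
Proof.
apply: knorm_lub => u u1; apply: le_trans (form_normD (coef_psd u) _ _) _.
by apply: lerD; exact: coef_ip_le.
Qed.

Lemma knormN x : knorm (- x) = knorm x.
Proof.
by apply/eqP; rewrite eq_le; apply/andP; split; apply: knorm_lub => u u1;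
  rewrite -(form_normN (coef_psd u)) ?opprK coef_ip_le.
Qed.

Lemma knormBC x y : knorm (x - y) = knorm (y - x).
Proof. by rewrite -knormN opprB. Qed.

Lemma knormB x y z : knorm (x - z) <= knorm (x - y) + knorm (y - z).
Proof. by have := knormD (x - y) (y - z); rewrite addrA subrK. Qed.

Lemma knormZ c x : knorm (c *: x) <= normc c * knorm x.
Proof.
apply: knorm_lub => u u1; rewrite (form_normZ (coef_psd u)).
by rewrite ler_wpM2l ?normc_ge0 // coef_ip_le.
Qed.

Lemma knorm0 : knorm 0 = 0.
Proof.
apply/eqP; rewrite eq_le knorm_ge0 andbT; apply: knorm_lub => u _.
by rewrite (form_norm0 (coef_psd u)).
Qed.

Lemma knorm_act a x : knorm (act a x) <= cop_norm a * knorm x.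
Proof.
rewrite -(@ler_pXn2r _ 2%N) ?nnegrE ?mulr_ge0 ?knorm_ge0 ?cop_norm_ge0 //.
rewrite exprMn !sqr_knorm (kip_act kP); apply: le_trans (cop_norm_mul _ _) _.
rewrite expr2 -mulrA ler_wpM2l ?cop_norm_ge0 //.
rewrite (cop_norm_adjoint (kip_adjoint kP x (act a x))) (kip_act kP).
exact: cop_norm_mul.
Qed.

Lemma kip_eq0_coef x y : (forall u, q u x y = 0) -> ip x y = 0.
Proof. exact: polarization. Qed.

Lemma knorm_eq0 x : (forall eps, 0 < eps -> knorm x < eps) -> x = 0.
Proof.
move=> x0; apply: (kip_eq0 kP); apply: kip_eq0_coef => u.
apply: (form_norm0P (coef_psd u)); apply/eqP; rewrite eq_le form_norm_ge0 andbT.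
apply/ler_addgt0Pr => r r0; rewrite add0r.
apply: le_trans (coef_ip_le_norm u x) _.
have M0 : 0 < N u + 1 by rewrite ltr_wpDl ?form_norm_ge0.
have := x0 (r / (N u + 1)) ltac:(by rewrite divr_gt0).
rewrite ltr_pdivlMr // => /ltW; apply: le_trans.
by rewrite ler_wpM2l ?knorm_ge0 // lerDl.
Qed.

(** Pythagoras holds for each q_u; after the supremum over u only an inequality survives. *)
Lemma knorm_orthogonal x y : ip x y = 0 -> knorm x <= knorm (x + y).
Proof.
move=> xy; apply: knorm_lub => u u1; apply: le_trans (coef_ip_le _ u1).
rewrite -(@ler_pXn2r _ 2%N) ?nnegrE ?form_norm_ge0 //.
by rewrite (sqr_form_normD (coef_psd u)) /coef_ip xy cop0 (form0l hP) mulr0 addr0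
  lerDl sqr_ge0.
Qed.

(* Orthogonality passes to limits: |<x, z>_u| <= |x - y| |z| |u|^2 if <y, z> = 0. *)
Lemma kip_closed x z :
  (forall eps : R, 0 < eps -> exists2 y, ip y z = 0 & knorm (x - y) < eps) ->
  ip x z = 0.
Proof.
move=> xz; apply: kip_eq0_coef => u; apply: normc_small_eq0 => r r0.
pose M := N u * (knorm z * N u) + 1.
have M0 : 0 < M by rewrite ltr_wpDl // !mulr_ge0 ?knorm_ge0 ?form_norm_ge0.
have [|y yz xy] := xz (r / M); first by rewrite divr_gt0.
have -> : q u x z = q u (x - y) z.
  by rewrite (formBl (coef_psd u)) [q u y z]/coef_ip yz cop0 (form0l hP) subr0.
apply: le_lt_trans (form_CS (coef_psd u) _ _) _.
apply: le_lt_trans (ler_pM _ _ (coef_ip_le_norm _ _) (coef_ip_le_norm _ _)) _;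
  rewrite ?form_norm_ge0 //.
rewrite -mulrA; rewrite ltr_pdivlMr // in xy; apply: le_lt_trans xy.
by rewrite ler_wpM2l ?knorm_ge0 // /M lerDl.
Qed.

Lemma kip_closedr x z :
  (forall eps : R, 0 < eps -> exists2 y, ip z y = 0 & knorm (x - y) < eps) ->
  ip z x = 0.
Proof.
move=> xz; rewrite -(kip0l 0); apply: kip_flip; rewrite kip0l.
apply: kip_closed => eps /xz[y zy xy]; exists y => //.
by rewrite -(kip0l 0); apply: kip_flip; rewrite kip0l.
Qed.

(** The norm closure. Density is proved by showing that this closed submodule is everything. *)
Definition adherence (G : set V) : set V :=
  [set x | forall eps : R, 0 < eps -> exists2 y, G y & knorm (x - y) < eps].

Lemma adherence_submodule (G : set V) :
  submodule (V := V') G -> submodule (V := V') (adherence G).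
Proof.
move=> [G0 GD GZ GA]; split=> [e e0|x y Gx Gy e e0|c x Gx e e0|a x Gx e e0].
- by exists 0; rewrite ?subr0 ?knorm0.
- have e2 : 0 < e / 2 by rewrite divr_gt0.
  have [x' Gx' xx'] := Gx _ e2; have [y' Gy' yy'] := Gy _ e2.
  exists (x' + y'); first exact: GD.
  rewrite opprD addrACA; apply: le_lt_trans (knormD _ _) _; lra.
- have c1 : 0 < normc c + 1 by rewrite ltr_wpDl ?normc_ge0.
  have [x' Gx' xx'] := Gx (e / (normc c + 1)) ltac:(by rewrite divr_gt0).
  exists (c *: x'); first exact: GZ.
  rewrite -scalerBr; apply: le_lt_trans (knormZ _ _) _.
  rewrite ltr_pdivlMr // in xx'; apply: le_lt_trans xx'.
  by rewrite mulrC ler_wpM2l ?knorm_ge0 // lerDl.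
- have c1 : 0 < cop_norm a + 1 by rewrite ltr_wpDl ?cop_norm_ge0.
  have [x' Gx' xx'] := Gx (e / (cop_norm a + 1)) ltac:(by rewrite divr_gt0).
  exists (act a x'); first exact: GA.
  rewrite -actBr; apply: le_lt_trans (knorm_act _ _) _.
  rewrite ltr_pdivlMr // in xx'; apply: le_lt_trans xx'.
  by rewrite mulrC ler_wpM2l ?knorm_ge0 // lerDl.
Qed.

Lemma adherence_closed (G : set V) : ip_closed (V := V') (adherence G).
Proof.
move=> x xG e e0; have e2 : 0 < e / 2 by rewrite divr_gt0.
have [y yG xy] := xG _ e2; have [z Gz yz] := yG _ e2.
by exists z => //; apply: le_lt_trans (knormB _ y _) _; lra.
Qed.

Lemma subset_adherence (G : set V) : G `<=` adherence G.
Proof. by move=> x Gx e e0; exists x => //; rewrite subrr knorm0. Qed.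

(** * The corner eV and complements of closed submodules *)

Section Corner.
Variables (e : compact_op H) (h : H).
Hypothesis eh : projects_on e h.
Local Notation theta u := (rank_one h u).
Local Notation rk := (rank_oneE eh).
Let hh := projects_on_unit eh.

Lemma act_eK x : act e (act e x) = act e x.
Proof. by rewrite -(kmod_actA kP) (projects_on_idem eh). Qed.

Lemma act_e_theta u x : act e (act (theta u) x) = act (theta u) x.
Proof.
rewrite -(kmod_actA kP); congr (act _ x); apply: cop_ext => w.
by rewrite cop_mulE !rk cop_opZ eh.2 hh scale1r.
Qed.

Lemma act_compression a x : act e x = x -> act e (act a x) = hdot (a h) h *: x.
Proof.
move=> ex; have -> : act e (act a x) = act (cop_mul e (cop_mul a e)) x.
  by rewrite !(kmod_actA kP) ex.
by rewrite (compression eh) (kmod_actZl kP) ex.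
Qed.

(** <x, theta_u y> is <x, y> composed with the adjoint of theta_u, which sends h to u. *)
Lemma kip_thetar x y u : ip x (act (theta u) y) h = ip x y u.
Proof.
apply/eqP; rewrite -subr_eq0; apply/eqP/hdot_eq0; set w := _ - _.
rewrite (formBl hP) !(kip_adjoint kP) (kip_act kP) cop_mulE rk (formZr hP) hh mulr1.
by rewrite -hdotC subrr.
Qed.

Lemma coef_theta u x y : q h (act (theta u) x) (act (theta u) y) = q u x y.
Proof.
by rewrite /coef_ip kip_thetar (kip_act kP) cop_mulE rk hdotZl hh mulr1.
Qed.

Lemma coef_norm_theta u x : form_norm (q h) (act (theta u) x) = form_norm (q u) x.
Proof. by rewrite /form_norm coef_theta. Qed.

(** On the corner theta_u x = theta_u (e x) = <h, u> x, so q_u is |<h, u>|^2 q_h and the supremum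
    over u is attained at h. *)
Lemma knorm_corner x : act e x = x -> knorm x = form_norm (q h) x.
Proof.
move=> ex; apply/eqP; rewrite eq_le; apply/andP; split.
  apply: knorm_lub => u u1; rewrite -coef_norm_theta -{1}ex -(kmod_actA kP).
  have -> : cop_mul (theta u) e = (hdot h u) *: e.
    by apply: cop_ext => w; rewrite cop_mulE copZ rk eh.2 hdotZl scalerA mulrC.
  rewrite (kmod_actZl kP) ex (form_normZ (coef_psd h)) ler_piMl ?form_norm_ge0 //.
  by apply: le_trans (form_CS hP _ _) _; rewrite eh.1 mul1r.
by apply: coef_ip_le; rewrite eh.1.
Qed.

(** For self-adjoint p, <x - p x, x - p x> = (1 - p) <x, x> (1 - p), so p x is close to x once p <x,
    x> is close to the compact operator <x, x>. Each summand of p passes through the corner: b (x) b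
    = (b (x) h) (h (x) b). *)
Lemma corner_span_dense x (eps : R) : 0 < eps -> exists F : {fset H},
  knorm (x - \sum_(b <- F) act (rank_one b h) (act (theta b) x)) < eps.
Proof.
move=> eps0; have e2 : 0 < (eps / 2) ^+ 2 by rewrite exprn_gt0 // divr_gt0.
have [F [padj pc ap]] := finite_rank_approximation eh (ip x x) e2.
exists F; move: padj pc ap; set p := \sum_(b <- F) _ => padj pc ap.
have -> : \sum_(b <- F) act (rank_one b h) (act (theta b) x) = act p x.
  rewrite act_suml; apply: eq_bigr => b _; rewrite -(kmod_actA kP).
  congr (act _ x); apply: cop_ext => w.
  by rewrite cop_mulE !rk hdotZl hh mulr1.
(* [knorm_lub] only gives a weak inequality, hence eps / 2; it is squared because the norm is the
   root of |<x, x>|. *)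
apply: le_lt_trans (_ : eps / 2 < eps); last by lra.
apply: knorm_lub => u u1.
rewrite -(@ler_pXn2r _ 2%N) ?nnegrE ?form_norm_ge0 ?divr_ge0 ?(ltW eps0) //.
rewrite (sqr_form_norm (coef_psd u)); apply: le_trans _ ap.
have -> : q u (x - act p x) (x - act p x) =
    hdot ((ip x x - cop_mul p (ip x x)) (u - p u)) u.
  rewrite /coef_ip kipBl (kip_act kP) !copB !cop_mulE (formBl hP).
  have key (z : H) : ip x (x - act p x) z = ip x x (z - p z).
    apply/eqP; rewrite -subr_eq0; apply/eqP/hdot_eq0; set w := _ - _.
    rewrite (formBl hP) !(kip_adjoint kP) kipBl (kip_act kP) copB cop_mulE.
    by rewrite (formBr hP) -padj -(formBl hP) subrr.
  by rewrite key (formBl hP).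
apply: le_trans (Re_le_normc _) _; apply: le_trans (form_CS hP _ _) _.
apply: le_trans (_ : cop_norm (ip x x - cop_mul p (ip x x)) * 1 <= _); last by rewrite mulr1.
apply: ler_pM; rewrite ?form_norm_ge0 // cop_norm_ub //.
exact: le_trans (pc u) u1.
Qed.

(** Serves as an induction principle: a closed property stable under the module operations need only
    be checked on eV. *)
Lemma closed_submodule_full (S : set V) : submodule (V := V') S ->
  ip_closed (V := V') S -> (forall x, S (act e x)) -> forall x, S x.
Proof.
move=> [S0 SD _ SA] Sc Se x; apply: Sc => eps /(corner_span_dense x)[F xF].
eexists; last exact: xF.
elim/big_rec : _ => // b y _ Sy; apply: SD => //; apply: SA.
by rewrite -act_e_theta; exact: Se.
Qed.

Lemma corner_complete (G : set V) : ip_closed (V := V') G ->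
  form_complete (q h) [set x | G x /\ act e x = x].
Proof.
move=> Gc g gG gc; have eB x y : act e x = x -> act e y = y -> act e (x - y) = x - y.
  by move=> ex ey; rewrite actBr ex ey.
have [|l lP] := (kip_complete kP) g.
  move=> r /gc[n0 n0P]; exists n0 => m n hm hn.
  by rewrite knorm_corner ?n0P //; apply: eB; [have [] := gG m|have [] := gG n].
have el : act e l = l.
  apply/eqP; rewrite -subr_eq0; apply/eqP; apply: knorm_eq0 => r r0.
  have c1 : 0 < cop_norm e + 1 by rewrite ltr_wpDl ?cop_norm_ge0.
  have [n0 /(_ n0 (leqnn _)) hn] := lP (r / (cop_norm e + 1)) ltac:(by rewrite divr_gt0).
  have -> : act e l - l = act e (l - g n0) - (l - g n0).
    by rewrite actBr (gG n0).2 opprB addrA subrK.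
  apply: le_lt_trans (knormD _ _) _; rewrite knormN.
  rewrite knormBC ltr_pdivlMr // in hn; apply: le_lt_trans hn.
  by rewrite mulrDr mulr1 lerD2r mulrC knorm_act.
exists l.
  split=> //; apply: Gc => r /lP[n0 /(_ n0 (leqnn _)) hn].
  by exists (g n0); [exact: (gG n0).1|rewrite knormBC].
move=> r /lP[n0 n0P]; exists n0 => n /n0P.
by rewrite knorm_corner //; apply: eB => //; exact: (gG n).2.
Qed.

(* The elements having a component in [G] form a closed submodule which
   contains [e V]: there the Hilbert space projection onto [e G] works. *)
Lemma orthogonal_decomposition (G : set V) : submodule (V := V') G ->
  ip_closed (V := V') G ->
  forall x, exists2 g, G g & forall y, G y -> ip (x - g) y = 0.
Proof.
move=> Gs Gc; have [G0 GD GZ GA] := Gs.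
pose S := [set x | exists2 g, G g & forall y, G y -> ip (x - g) y = 0].
apply: (@closed_submodule_full S).
- split=> [|x y [g Gg gP] [k Gk kP']|c x [g Gg gP]|a x [g Gg gP]].
  + by exists 0 => // y _; rewrite subr0 kip0l.
  + exists (g + k); first exact: GD.
    by move=> z Gz; rewrite opprD addrACA (kipDl kP) gP // kP' // addr0.
  + exists (c *: g); first exact: GZ.
    by move=> z Gz; rewrite -scalerBr (kipZl kP) gP // scaler0.
  + exists (act a g); first exact: GA.
    move=> z Gz; rewrite -actBr (kip_act kP) gP //; apply: cop_ext => w.
    by rewrite cop_mulE !cop0 cop_op0.
- move=> x xS.
  (* Taking components is a contraction, since (y - g) - (z - k) is orthogonal to g - k; so the
     components of a convergent sequence form a Cauchy sequence. *)
  have contr y z g k : G g -> G k -> (forall t, G t -> ip (y - g) t = 0) ->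
      (forall t, G t -> ip (z - k) t = 0) -> knorm (g - k) <= knorm (y - z).
    move=> Gg Gk gP kP'.
    have -> : y - z = (g - k) + ((y - g) - (z - k)).
      by rewrite (opprB z k) [k - z]addrC [y - g + _]addrACA [- g + k]addrC
        -(opprB g k) [RHS]addrC subrK.
    apply: knorm_orthogonal; rewrite -(kip0l 0); apply: kip_flip; rewrite kip0l.
    have Ggk : G (g - k) by apply: GD => //; rewrite -scaleN1r; exact: GZ.
    by rewrite kipBl gP // kP' // subrr.
  have [yg ygP] : {yg : nat -> V * V & forall n, [/\ G (yg n).2,
      (forall t, G t -> ip ((yg n).1 - (yg n).2) t = 0) & knorm (x - (yg n).1) < n.+1%:R^-1]}.
    apply: (@boolp.choice _ _ (fun n (p : V * V) => [/\ G p.2,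
      (forall t, G t -> ip (p.1 - p.2) t = 0) & knorm (x - p.1) < n.+1%:R^-1])) => n.
    have [|y [g Gg gP] xy] := xS n.+1%:R^-1; first by rewrite invr_gt0.
    by exists (y, g).
  have ygc r : 0 < r -> exists n0, forall m n, (n0 <= m)%N -> (n0 <= n)%N ->
     knorm ((yg m).2 - (yg n).2) < r.
    move=> r0; have [|n0 n0P] := @inv_small R (r / 2); first by rewrite divr_gt0.
    exists n0 => m n /n0P hm /n0P hn.
    have [Gm mP xm] := ygP m; have [Gn nP xn] := ygP n.
    apply: le_lt_trans (contr _ _ _ _ Gm Gn mP nP) _.
    apply: le_lt_trans (knormB _ x _) _; rewrite knormBC.
    move: xm xn hm hn; move: (m.+1%:R^-1) (n.+1%:R^-1) => r1 r2; lra.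
  have [l lP] := (kip_complete kP) _ ygc.
  exists l.
    apply: Gc => r /lP[n0 /(_ n0 (leqnn _)) hn].
    by exists (yg n0).2; [have [] := ygP n0|rewrite knormBC].
  move=> y Gy; apply: kip_closed => r r0.
  have r20 : 0 < r / 2 by rewrite divr_gt0.
  have [n1 n1P] := lP _ r20; have [n2 n2P] := inv_small r20.
  pose n := maxn n1 n2; have [Gn nP xn] := ygP n.
  exists ((yg n).1 - (yg n).2); first exact: nP.
  have -> : x - l - ((yg n).1 - (yg n).2) = (x - (yg n).1) + ((yg n).2 - l).
    by rewrite opprB [_ - (yg n).1]addrC addrACA [- l + _]addrC.
  apply: le_lt_trans (knormD _ _) _.
  have := n1P n (leq_maxl _ _); have := n2P n (leq_maxr _ _); move: xn.
  by move: (n.+1%:R^-1) => r1; lra.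
- move=> x.
  have [|||g [Gg eg] gP] := @form_projection R V (q h) (coef_psd h)
      [set x | G x /\ act e x = x] _ _ _ (corner_complete Gc) (act e x).
  + by split=> //; rewrite act0r.
  + by move=> y z [Gy ey] [Gz ez]; split; [exact: GD|rewrite (kmod_actDr kP) ey ez].
  + by move=> c y [Gy ey]; split; [exact: GZ|rewrite (kmod_actZr kP) ey].
  exists g => // y Gy; apply: cop_ext => u.
  (* With z = e x - g = e z, the vector <z, y> u is a multiple of h, with coefficient q_h(z, theta_u
     y); this vanishes as theta_u y lies in both G and eV. *)
  have ez : act e (act e x - g) = act e x - g by rewrite actBr act_eK eg.
  rewrite -ez (kip_act kP) cop_mulE eh.2 cop0.
  have := gP (act (theta u) y) (conj (GA _ _ Gy) (act_e_theta u y)).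
  by rewrite /coef_ip kip_thetar => ->; rewrite scale0r.
Qed.

End Corner.
End KModule.

(** Stated for any [ipModule] so that it also covers the corner, whose coefficients are scalars;
    [orthoproj] is a choice, identified through uniqueness. *)
Lemma is_orthoproj_unique (R : realType) (V : ipModule R) (G : set V) (P Q : V -> V) :
  (forall x y z : V, ip (x - y) z = ip x z - ip y z) ->
  (forall x : V, ip x x = 0 -> x = 0) ->
  (forall x y, G x -> G y -> G (x - y)) ->
  is_orthoproj G P -> is_orthoproj G Q -> P = Q.
Proof.
move=> ipB ip0 GB PP QP; apply/funext => x.
have [GP PP'] := PP x; have [GQ QP'] := QP x.
apply/eqP; rewrite -subr_eq0; apply/eqP; apply: ip0.
have -> : P x - Q x = (x - Q x) - (x - P x) by rewrite opprB [RHS]addrC addrA subrK.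
by rewrite ipB QP' ?PP' ?subrr // opprB addrC addrA subrK; exact: GB.
Qed.

(** * The direct sum of two copies of a module *)

Section ModuleSum.
Context {R : realType} {H : hilbertType R} {V : lmodType R[i]}.
Variables (act : compact_op H -> V -> V) (ip : V -> V -> compact_op H).
Hypothesis kP : is_kmodule act ip.
Local Notation N := (form_norm (@hdot R H)).
Local Notation hP := (@hdot_psd R H).

Definition act_sum (a : compact_op H) (z : V * V) : V * V := (act a z.1, act a z.2).
Definition kip_sum (z w : V * V) : compact_op H := ip z.1 w.1 + ip z.2 w.2.
Local Notation knorm := (@ip_norm R (compact_ipModule act ip)).
Local Notation knorm2 := (@ip_norm R (compact_ipModule act_sum kip_sum)).

Let kip_sum_adjoint z w : cop_adjoint (kip_sum z w) (kip_sum w z).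
Proof.
by move=> u v; rewrite !copD hdotDl (formDr hP) !(kip_adjoint kP).
Qed.

Let kip_sum_ge0 z u : 0 <= hdot (kip_sum z z u) u.
Proof. by rewrite copD hdotDl addr_ge0 // (kip_ge0 kP). Qed.

Let coef_sum u z : form_norm (coef_ip kip_sum u) z ^+ 2 =
  form_norm (coef_ip ip u) z.1 ^+ 2 + form_norm (coef_ip ip u) z.2 ^+ 2.
Proof.
rewrite /form_norm !sqr_sqrtr.
- rewrite /coef_ip copD hdotDl.
  by case: (hdot (ip z.1 z.1 u) u) (hdot (ip z.2 z.2 u) u) => a b [c d].
- exact: (Re_form_ge0 (coef_psd kP u)).
- exact: (Re_form_ge0 (coef_psd kP u)).
- by have := kip_sum_ge0 z u; rewrite lecE => /andP[].
Qed.

Let coef_sum_le u z : N u <= 1 -> form_norm (coef_ip kip_sum u) z <= knorm2 z.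
Proof.
move=> u1; rewrite ler_sqrt ?cop_norm_ge0 //.
apply: le_trans (Re_le_normc _) _; apply: le_trans (form_CS hP _ _) _.
apply: le_trans (cop_norm_ub _ u1); by rewrite ler_piMr ?form_norm_ge0.
Qed.

Lemma knorm_fst z : knorm z.1 <= knorm2 z.
Proof.
apply: (knorm_lub kP) => u u1; apply: le_trans (coef_sum_le z u1).
by rewrite -(@ler_pXn2r _ 2%N) ?nnegrE ?form_norm_ge0 // coef_sum lerDl sqr_ge0.
Qed.

Lemma knorm_snd z : knorm z.2 <= knorm2 z.
Proof.
apply: (knorm_lub kP) => u u1; apply: le_trans (coef_sum_le z u1).
by rewrite -(@ler_pXn2r _ 2%N) ?nnegrE ?form_norm_ge0 // coef_sum lerDr sqr_ge0.
Qed.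

Lemma knorm_pair z : knorm2 z <= knorm z.1 + knorm z.2.
Proof.
have r0 : 0 <= knorm z.1 + knorm z.2 by rewrite addr_ge0 ?knorm_ge0.
rewrite -(@ler_pXn2r _ 2%N) ?nnegrE ?knorm_ge0 //.
rewrite sqr_sqrtr ?cop_norm_ge0 //.
apply: cop_norm_positive => [|u|u u1]; [exact: kip_sum_adjoint|exact: kip_sum_ge0|].
have := coef_sum u z; rewrite {1}/form_norm sqr_sqrtr; last first.
  by have := kip_sum_ge0 z u; rewrite lecE => /andP[].
rewrite /(coef_ip kip_sum) => ->.
have h1 := coef_ip_le act ip z.1 u1; have h2 := coef_ip_le act ip z.2 u1.
rewrite sqrrD.
have : form_norm (coef_ip ip u) z.1 ^+ 2 <= knorm z.1 ^+ 2
  by rewrite ler_pXn2r ?nnegrE ?knorm_ge0 ?form_norm_ge0.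
have : form_norm (coef_ip ip u) z.2 ^+ 2 <= knorm z.2 ^+ 2
  by rewrite ler_pXn2r ?nnegrE ?knorm_ge0 ?form_norm_ge0.
have : 0 <= knorm z.1 * knorm z.2 by rewrite mulr_ge0 ?knorm_ge0.
rewrite -mulr_natl; lra.
Qed.

(** Opens the results on closed submodules to graphs, which live in the sum. *)
Lemma is_kmodule_sum : is_kmodule act_sum kip_sum.
Proof.
split.
- by move=> a x y; rewrite /act_sum !(kmod_actDr kP).
- by move=> a b x; rewrite /act_sum !(kmod_actDl kP).
- by move=> c a x; rewrite /act_sum !(kmod_actZr kP).
- by move=> c a x; rewrite /act_sum !(kmod_actZl kP).
- by move=> a b x; rewrite /act_sum !(kmod_actA kP).
- by move=> x y z; rewrite /kip_sum !(kipDl kP) addrACA.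
- by move=> c x y; rewrite /kip_sum !(kipZl kP) scalerDr.
- move=> a x y; rewrite /kip_sum !(kip_act kP); apply: cop_ext => u.
  by rewrite !cop_mulE !copD !cop_mulE cop_opD.
- exact: kip_sum_adjoint.
- exact: kip_sum_ge0.
- move=> [x y] xy0.
  have z1 u : form_norm (coef_ip ip u) x ^+ 2 + form_norm (coef_ip ip u) y ^+ 2 = 0.
    by rewrite -(coef_sum u (x, y)) /form_norm /coef_ip xy0 cop0 (form0l hP) sqrtr0 expr0n.
  have {}z1 u : (form_norm (coef_ip ip u) x == 0) && (form_norm (coef_ip ip u) y == 0).
    by rewrite -(sqrf_eq0 (form_norm _ x)) -(sqrf_eq0 (form_norm _ y)) -paddr_eq0 ?sqr_ge0 // z1.
  congr (_, _); apply: (kip_eq0 kP); apply: kip_eq0_coef => u;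
    have /andP[/eqP ux /eqP uy] := z1 u; exact: (form_norm0P (coef_psd kP u)).
- move=> g gc.
  have [|l1 l1P] := (kip_complete kP) (fun n => (g n).1).
    move=> r /gc[n0 n0P]; exists n0 => m n hm hn.
    by apply: le_lt_trans (n0P m n hm hn); exact: (knorm_fst (g m - g n)).
  have [|l2 l2P] := (kip_complete kP) (fun n => (g n).2).
    move=> r /gc[n0 n0P]; exists n0 => m n hm hn.
    by apply: le_lt_trans (n0P m n hm hn); exact: (knorm_snd (g m - g n)).
  exists (l1, l2) => r r0; have r2 : 0 < r / 2 by rewrite divr_gt0.
  have [n1 n1P] := l1P _ r2; have [n2 n2P] := l2P _ r2.
  exists (maxn n1 n2) => n; rewrite geq_max => /andP[/n1P h1 /n2P h2].
  apply: le_lt_trans (knorm_pair _) _ => /=; lra.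
Qed.

End ModuleSum.

Lemma is_kmodule_kmodule (R : realType) (H : hilbertType R) (E : hilbertKModType H) :
  is_kmodule (@kact R H E) (@kdot R H E).
Proof.
have knE (x : E) : @ip_norm R (kmodule E) x = complex.Re `|x|.
  have := kdot_norm x; rewrite {1}(complex_ge0_real (normr_ge0 x)) -rmorphXn => /complexI nx.
  rewrite /ip_norm /= -nx sqrtr_sqr ger0_norm //.
  by have := normr_ge0 x; rewrite lecE => /andP[].
split; [exact: kactDr|exact: kactDl|exact: kactZr|exact: kactZl|exact: kactA|
  exact: kdotDl|exact: kdotZl|exact: kdot_act|exact: kdot_adjoint|exact: kdot_ge0| |].
- move=> x x0; apply/normr0_eq0.
  rewrite (complex_ge0_real (normr_ge0 x)) -knE /ip_norm /= x0.
  suff -> : cop_norm (0 : compact_op H) = 0 by rewrite sqrtr0.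
  apply/eqP; rewrite eq_le cop_norm_ge0 andbT; apply: cop_norm_lub => u _.
  by rewrite cop0 (form_norm0 hdot_psd).
- move=> g gc; have [|l lP] := @complete_normed_seq R E g.
    by move=> r /gc[n0 n0P]; exists n0 => m n hm hn; rewrite -knE; exact: n0P.
  by exists l => r /lP[n0 n0P]; exists n0 => n /n0P; rewrite -knE.
Qed.

(** * Orthogonal projections onto closed submodules *)

Section OrthogonalProjection.
Context {R : realType} {H : hilbertType R} {V : lmodType R[i]}.
Variables (act : compact_op H -> V -> V) (ip : V -> V -> compact_op H).
Hypothesis kP : is_kmodule act ip.
Variables (e : compact_op H) (h : H).
Hypothesis eh : projects_on e h.
Local Notation V' := (compact_ipModule act ip).
Local Notation knorm := (@ip_norm R V').
Variable (G : set V).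
Hypotheses (Gs : submodule (V := V') G) (Gc : ip_closed (V := V') G).
Local Notation P := (orthoproj (V := V') G).

Lemma orthoprojP : is_orthoproj (V := V') G P.
Proof.
have [p pP] : {p : V -> V & is_orthoproj (V := V') G p}.
  apply: (@boolp.choice _ _ (fun x g => G g /\ forall y, G y -> ip (x - g) y = 0)) => x.
  by have [g Gg gP] := orthogonal_decomposition kP eh Gs Gc x; exists g.
by apply: (xgetPex (fun=> 0)); exists p.
Qed.

Lemma orthoproj_orthogonal x y : G y -> ip (x - P x) y = 0.
Proof. by have [_] := orthoprojP x; apply. Qed.

Lemma submoduleB x y : G x -> G y -> G (x - y).
Proof. by case: Gs => _ GD GZ _ Gx Gy; apply: GD => //; rewrite -scaleN1r; exact: GZ. Qed.

Lemma orthoproj_eq x g : G g -> (forall y, G y -> ip (x - g) y = 0) -> P x = g.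
Proof.
move=> Gg gP; have [GP PP] := orthoprojP x.
apply/eqP; rewrite -subr_eq0; apply/eqP; apply: (kip_eq0 kP).
have -> : P x - g = (x - g) - (x - P x) by rewrite opprB [RHS]addrC addrA subrK.
have GB : G (x - g - (x - P x)) by rewrite opprB addrC addrA subrK; exact: submoduleB.
by rewrite (kipBl kP) gP // orthoproj_orthogonal // subrr.
Qed.

Lemma orthoproj_act a x : P (act a x) = act a (P x).
Proof.
have [GP PP] := orthoprojP x; apply: orthoproj_eq.
  by case: Gs => _ _ _ GA; exact: GA.
move=> y Gy; rewrite -(actBr kP) (kip_act kP) orthoproj_orthogonal //; apply: cop_ext => w.
by rewrite cop_mulE !cop0 cop_op0.
Qed.

Lemma orthoproj_contraction x : knorm (P x) <= knorm x.
Proof.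
have [GP PP] := orthoprojP x; rewrite -{2}(subrK (P x) x) [_ - _ + _]addrC.
apply: (knorm_orthogonal kP); rewrite -(kip0l kP 0); apply: (kip_flip kP).
by rewrite orthoproj_orthogonal // (kip0l kP).
Qed.

End OrthogonalProjection.

Section CornerInner.
Context {R : realType} {H : hilbertType R} {V : lmodType R[i]}.
Variables (act : compact_op H -> V -> V) (ip : V -> V -> compact_op H).
Hypothesis kP : is_kmodule act ip.
Variables (e : compact_op H) (h : H).
Hypothesis eh : projects_on e h.
Local Notation V' := (compact_ipModule act ip).
Local Notation knorm := (@ip_norm R V').
Local Notation hP := (@hdot_psd R H).

(** <x, y> = e <x, y> e is a multiple of e, so the trace merely reads off the coefficient. *)
Lemma kip_corner x y : act e x = x -> act e y = y ->
  ip x y = coef_ip ip h x y *: e.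
Proof.
move=> ex ey; apply: cop_ext => w; rewrite -{1}ex (kip_act kP) cop_mulE copZ !eh.2.
rewrite scalerA; congr (_ *: _).
rewrite (kip_adjoint kP) -{1}ey (kip_act kP) cop_mulE eh.2 (formZr hP) -hdotC.
by rewrite /coef_ip (kip_adjoint kP).
Qed.

Lemma knorm_act_e x : knorm (act e x) <= knorm x.
Proof.
rewrite (knorm_corner kP eh (act_eK kP eh x)).
have -> : act e x = act (rank_one h h) x by rewrite -(projects_onE eh).
by rewrite (coef_norm_theta kP eh) (coef_ip_le act ip) // eh.1.
Qed.

Lemma knorm_lub_corner x (r : R) :
  (forall u, form_norm (@hdot R H) u <= 1 -> knorm (act (rank_one h u) x) <= r) ->
  knorm x <= r.
Proof.
move=> xr; apply: (knorm_lub kP) => u /xr.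
by rewrite (knorm_corner kP eh (act_e_theta kP eh u x)) (coef_norm_theta kP eh).
Qed.

Lemma knorm_theta u x : form_norm (@hdot R H) u <= 1 ->
  knorm (act (rank_one h u) x) <= knorm x.
Proof.
move=> u1; rewrite (knorm_corner kP eh (act_e_theta kP eh u x)) (coef_norm_theta kP eh).
exact: coef_ip_le.
Qed.

Lemma theta_eq0 x : (forall u, act (rank_one h u) x = 0) -> x = 0.
Proof.
move=> x0; apply: (kip_eq0 kP); apply: kip_eq0_coef => u.
by rewrite -(coef_theta kP eh) x0 /coef_ip (kip0l kP) cop0 (form0l hP).
Qed.

End CornerInner.

Lemma hdot_ext (R : realType) (H : hilbertType R) (u v : H) :
  (forall w, hdot u w = hdot v w) -> u = v.
Proof.
move=> uv; apply/eqP; rewrite -subr_eq0; apply/eqP/hdot_eq0.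
by rewrite (formBl hdot_psd) uv subrr.
Qed.

(** * The map psi *)

Section CornerMap.
Context {R : realType} {H : hilbertType R} {E : hilbertKModType H}.
Variables (e : compact_op H) (h : H).
Hypothesis eh : projects_on e h.
Local Notation K := (kmodule E).
Local Notation C := (corner_space E e).
Local Notation kE := (is_kmodule_kmodule E).
Local Notation kS := (is_kmodule_sum (is_kmodule_kmodule E)).
Local Notation knorm := (@ip_norm R K).
Local Notation knorm2 := (@ip_norm R (ip_sum K)).
Local Notation hP := (@hdot_psd R H).
Implicit Types (t s : graph_op K) (x y : C).

Lemma kdotNr (x y : E) : kdot x (- y) = - kdot x y.
Proof.
apply: cop_ext => u; apply: hdot_ext => v.
by rewrite copN (formNl hP) !(kip_adjoint kE) (kipNl kE) copN (formNr hP).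
Qed.

Lemma corner_fixed x : kact e (corner_val x) = corner_val x.
Proof. by case: x => x /= /asboolP[y ->]; exact: (act_eK kE eh). Qed.

Definition to_corner (x : E) : C :=
  @Corner R H E e (kact e x) (asboolT (ex_intro _ x erefl)).

Lemma to_cornerE z : corner_val (to_corner z) = kact e z. Proof. by []. Qed.

Lemma to_cornerK x : to_corner (corner_val x) = x.
Proof. by apply: val_inj; exact: corner_fixed. Qed.

Lemma to_cornerD (x y : E) : to_corner (x + y) = to_corner x + to_corner y.
Proof. by apply: val_inj; exact: (kmod_actDr kE). Qed.

Lemma to_cornerZ (c : R[i]) (x : E) : to_corner (c *: x) = c *: to_corner x.
Proof. by apply: val_inj; exact: (kmod_actZr kE). Qed.

Lemma to_corner0 : to_corner 0 = 0.
Proof. by apply: val_inj; exact: (act0r kE). Qed.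

Lemma to_cornerB (x y : E) : to_corner (x - y) = to_corner x - to_corner y.
Proof. by apply: val_inj; exact: (actBr kE). Qed.

Lemma ip_corner x y : ip x y = coef_ip kdot h (corner_val x) (corner_val y).
Proof.
rewrite /= (kip_corner kE eh (corner_fixed x) (corner_fixed y)).
exact: (trace_scale eh).
Qed.

Definition corner_pair (z : C * C) : E * E := (corner_val z.1, corner_val z.2).

Definition to_corner_pair (z : E * E) : C * C := (to_corner z.1, to_corner z.2).

Lemma corner_pair_fixed z : act_sum (@kact R H E) e (corner_pair z) = corner_pair z.
Proof. by rewrite /act_sum !corner_fixed. Qed.

Lemma to_corner_pairK z : act_sum (@kact R H E) e z = z -> corner_pair (to_corner_pair z) = z.
Proof. by []. Qed.

Lemma ip_corner_pair (z w : C * C) : @ip R (ip_sum C) z w =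
  coef_ip (kip_sum (@kdot R H E)) h (corner_pair z) (corner_pair w).
Proof.
have -> : @ip R (ip_sum C) z w = ip z.1 w.1 + ip z.2 w.2 by [].
by rewrite !ip_corner /coef_ip -hdotDl.
Qed.

Lemma norm_corner x : ip_norm x = knorm (corner_val x).
Proof.
apply: etrans (esym (knorm_corner kE eh (corner_fixed x))).
rewrite /ip_norm ip_corner /form_norm.
by rewrite (form_self (coef_psd kE h)) /= expr0n /= addr0 sqrtr_sqr ger0_norm ?sqr_ge0.
Qed.

Lemma norm_corner_pair (z : C * C) : @ip_norm R (ip_sum C) z = knorm2 (corner_pair z).
Proof.
apply: etrans (esym (knorm_corner kS eh (corner_pair_fixed z))).
rewrite /ip_norm ip_corner_pair /form_norm.
by rewrite (form_self (coef_psd kS h)) /= expr0n /= addr0 sqrtr_sqr ger0_norm ?sqr_ge0.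
Qed.

(** The graph of t_e is the part of G(t) inside eE (+) eE: an element x = e x of Dom(t) is its own
    witness for membership in e Dom(t). *)
Lemma psiE t x y : psi e t (x, y) = t (corner_val x, corner_val y).
Proof.
apply/propext; split=> [[]//|txy]; split=> //.
exists (corner_val x); last by rewrite corner_fixed.
by exists (corner_val y).
Qed.

Lemma dom_submodule t : submodule (V := ip_sum K) t -> submodule (V := K) (dom t).
Proof.
move=> [t0 tD tZ tA]; split=> [|x y [tx tx'] [ty ty']|c x [tx tx']|a x [tx tx']].
- by exists 0.
- by exists (tx + ty); exact: (tD _ _ tx' ty').
- by exists (c *: tx); exact: (tZ c _ tx').
- by exists (kact a tx); exact: (tA a _ tx').
Qed.

Lemma psi_to_corner t (x y : E) : submodule (V := ip_sum K) t -> t (x, y) ->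
  psi e t (to_corner x, to_corner y).
Proof. by move=> [_ _ _ tA] txy; rewrite psiE; exact: (tA e _ txy). Qed.

(** t x = t (e x) = e (t x): t maps the corner into itself, so intermediate values in sums and
    composites may be read there. *)
Lemma psi_val t x (y : E) : closed_op t -> t (corner_val x, y) -> corner_val (to_corner y) = y.
Proof.
move=> [tf ts _ _] txy; apply: tf (txy).
by have := psi_to_corner ts txy; rewrite psiE to_cornerK.
Qed.

Lemma closed_op_psi t : closed_op t -> closed_op (psi e t).
Proof.
move=> tc; have [tf ts td tcl] := tc; have [t0 tD tZ tA] := ts; split.
- by move=> x y z; rewrite !psiE => ty tz; apply: val_inj; exact: (tf _ _ _ ty tz).
- have tz c (z : C * C) : psi e t z -> psi e t (c *: z).
    by case: z => x y; rewrite !psiE; exact: tZ.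
  split=> [|[x1 x2] [y1 y2]||] //; first by rewrite psiE.
  by rewrite !psiE; exact: tD.
- move=> x eps eps0; have [y [ty yty] xy] := td (corner_val x) eps eps0.
  exists (to_corner y); first by exists (to_corner ty); exact: psi_to_corner.
  rewrite norm_corner -{1}(to_cornerK x) -to_cornerB to_cornerE.
  exact: le_lt_trans (knorm_act_e kE eh _) xy.
- move=> [x1 x2] xt; rewrite psiE; apply: tcl => eps /xt[[y1 y2]].
  rewrite psiE => ty; rewrite norm_corner_pair => xy.
  by exists (corner_val y1, corner_val y2).
Qed.

(** Letting b range over all of K(H) makes the graph stable under the action by associativity; the
    condition at b = e returns r. *)
Lemma psi_onto (r : graph_op C) : closed_op r -> exists2 t, closed_op t & psi e t = r.
Proof.
move=> [rf rs rd rcl]; have [r0 rD rZ _] := rs.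
pose t : graph_op K := [set xy | forall b, r (to_corner (kact b xy.1), to_corner (kact b xy.2))].
have rt x y : r (x, y) -> t (corner_val x, corner_val y).
  (* On the corner e b z is the scalar multiple <b h, h> z, so the condition at b follows from
     linearity of r. *)
  move=> rxy b /=; have lam z : to_corner (kact b (corner_val z)) = hdot (b h) h *: z.
    by apply: val_inj; exact: (act_compression kE eh b (corner_fixed z)).
  by rewrite !lam; exact: (rZ _ _ rxy).
have ts : submodule (V := ip_sum K) t.
  split=> [b|x y tx ty b|c x tx b|a x tx b] /=.
  - by rewrite (act0r kE) to_corner0; exact: r0.
  - by rewrite !(kmod_actDr kE) !to_cornerD; exact: (rD _ _ (tx b) (ty b)).
  - by rewrite !(kmod_actZr kE) !to_cornerZ; exact: (rZ _ _ (tx b)).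
  - by rewrite -!(kmod_actA kE); exact: tx.
exists t; first split=> //.
- move=> x y z ty tz; apply/eqP; rewrite -subr_eq0; apply/eqP.
  apply: (theta_eq0 kE eh) => u; have := rf _ _ _ (ty (rank_one h u)) (tz (rank_one h u)).
  move=> /(congr1 (@corner_val _ _ _ _)) /=.
  by rewrite !(act_e_theta kE eh) (actBr kE) => ->; rewrite subrr.
(* The closure of Dom(t) is a closed submodule, and contains eE because Dom(r) is dense there. *)
- have ds := dom_submodule ts.
  apply: (closed_submodule_full kE eh (adherence_submodule kE ds)).
    exact: (adherence_closed kE).
  move=> x eps eps0; have [y [ry yry] xy] := rd (to_corner x) eps eps0.
  exists (corner_val y); first by exists (corner_val ry); exact: rt.
  by move: xy; rewrite norm_corner.
- move=> x xt b; apply: rcl => eps eps0.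
  have c1 : 0 < cop_norm b + 1 by rewrite ltr_wpDl ?cop_norm_ge0.
  have [y ty xy] := xt (eps / (cop_norm b + 1)) ltac:(by rewrite divr_gt0).
  exists (to_corner (kact b y.1), to_corner (kact b y.2)); first exact: ty.
  rewrite norm_corner_pair.
  have -> : corner_pair ((to_corner (kact b x.1), to_corner (kact b x.2)) -
      (to_corner (kact b y.1), to_corner (kact b y.2))) =
      act_sum (@kact R H E) e (act_sum (@kact R H E) b (x - y)).
    by rewrite /corner_pair /act_sum; congr (_, _) => /=; rewrite !(actBr kE).
  apply: le_lt_trans (knorm_act_e kS eh _) _.
  apply: le_lt_trans (knorm_act kS _ _) _.
  rewrite ltr_pdivlMr // in xy; apply: le_lt_trans xy.
  by rewrite mulrC ler_wpM2l ?knorm_ge0 // lerDl.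
- apply/seteqP; split=> [[x y]|[x y] rxy]; rewrite psiE; last exact: rt.
  by move=> /(_ e) /=; rewrite !corner_fixed !to_cornerK.
Qed.

(** * Graph projections and the gap metric *)

Lemma orthoproj_psi t (z : C * C) : closed_op t ->
  corner_pair (orthoproj (V := ip_sum C) (psi e t) z) =
  orthoproj (V := ip_sum K) t (corner_pair z).
Proof.
move=> tc; have [_ ts _ tcl] := tc.
(* The projection onto G(t) commutes with e, so it preserves eE (+) eE; its restriction satisfies
   the defining property of the projection onto the graph of t_e. *)
pose Pc (z : C * C) : C * C := to_corner_pair (orthoproj (V := ip_sum K) t (corner_pair z)).
have PcE w : corner_pair (Pc w) = orthoproj (V := ip_sum K) t (corner_pair w).
  apply: to_corner_pairK; rewrite -(orthoproj_act kS eh ts tcl).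
  by rewrite corner_pair_fixed.
suff -> : orthoproj (V := ip_sum C) (psi e t) = Pc by exact: PcE.
have ptE w : psi e t w = t (corner_pair w) by case: w => x y; exact: psiE.
have PcP : is_orthoproj (V := ip_sum C) (psi e t) Pc.
  move=> w; rewrite ptE PcE; split; first exact: (orthoprojP kS eh ts tcl _).1.
  move=> y; rewrite ptE => ty; rewrite ip_corner_pair.
  have -> : corner_pair (w - Pc w) = corner_pair w - corner_pair (Pc w) by [].
  by rewrite PcE /coef_ip (orthoproj_orthogonal kS eh ts tcl _ ty) cop0 (form0l hP).
apply: xget_unique => // Q QP; apply: (is_orthoproj_unique _ _ _ QP PcP).
- by move=> x y w; rewrite !ip_corner_pair -(formBl (coef_psd kS h)).
- move=> x; rewrite ip_corner_pair => xx.
  have : corner_pair x = 0.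
    apply: (kip_eq0 kS).
    by rewrite (kip_corner kS eh (corner_pair_fixed x) (corner_pair_fixed x)) xx scale0r.
  by case: x {xx} => x y [x0 y0]; congr (_, _); apply: val_inj.
- by move=> x y; rewrite !ptE; exact: (submoduleB ts).
Qed.

(** Restriction to the corner can only shrink the supremum. Conversely theta_u D x = D (theta_u x),
    where theta_u x is in the unit ball of the corner, and the norms of these elements determine
    that of D x. *)
Lemma gap_psi t s : closed_op t -> closed_op s -> gap t s = gap (psi e t) (psi e s).
Proof.
move=> tc sc; have [_ ts _ tcl] := tc; have [_ ss _ scl] := sc.
pose D (z : E * E) : E * E := orthoproj (V := ip_sum K) t z - orthoproj (V := ip_sum K) s z.
pose Dc (z : C * C) : C * C :=
  orthoproj (V := ip_sum C) (psi e t) z - orthoproj (V := ip_sum C) (psi e s) z.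
have DcE z : corner_pair (Dc z) = D (corner_pair z).
  by rewrite /D -!orthoproj_psi.
rewrite /gap /ip_opnorm -/D -/Dc.
set A := [set knorm2 _ | _ in _]; set B := [set @ip_norm R (ip_sum C) _ | _ in _].
have A0 : A !=set0 by exists (knorm2 (D 0)), 0 => //=; rewrite (knorm0 kS).
have B0 : B !=set0.
  exists (@ip_norm R (ip_sum C) (Dc 0)), 0 => //=.
  by rewrite norm_corner_pair (knorm0 kS).
(* A [sup] is informative only for bounded sets; the difference of two contractions is bounded by
   2. *)
have A2 : has_ubound A.
  exists (1 + 1) => _ [x /= x1 <-]; apply: le_trans (knormD kS _ _) _.
  rewrite (knormN kS); apply: lerD; apply: le_trans x1.
    exact: (orthoproj_contraction kS eh ts tcl).
  exact: (orthoproj_contraction kS eh ss scl).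
have BA : B `<=` A.
  move=> _ [z /= z1 <-]; exists (corner_pair z); first by rewrite /= -norm_corner_pair.
  by rewrite norm_corner_pair DcE.
have B2 : has_ubound B by have [m Am] := A2; exists m => b /BA; exact: Am.
apply/eqP; rewrite eq_le; apply/andP; split; last first.
  by apply: ge_sup => // b /BA Ab; exact: ub_le_sup.
apply: ge_sup => // _ [x /= x1 <-]; apply: (knorm_lub_corner kS eh) => u u1.
have -> : act_sum (@kact R H E) (rank_one h u) (D x) =
    D (act_sum (@kact R H E) (rank_one h u) x).
  rewrite /D (orthoproj_act kS eh ts tcl) (orthoproj_act kS eh ss scl).
  exact: (actBr kS).
have cK := to_corner_pairK (act_e_theta kS eh u x).
rewrite -cK -DcE -norm_corner_pair; apply: ub_le_sup => //.
exists (to_corner_pair (act_sum (@kact R H E) (rank_one h u) x)) => //=.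
by rewrite norm_corner_pair cK; apply: le_trans (knorm_theta kS eh _ u1) x1.
Qed.

(** * Adjoints and algebraic operations *)

Lemma op_adjointE t (y z : E) : op_adjoint t (y, z) <->
  forall x tx : E, t (x, tx) -> kdot y tx = kdot z x.
Proof. by split=> tyz x tx /tyz /(kip_flip kE). Qed.

(** Over a general C*-algebra the adjoint may fail to be densely defined. Here the closure of its
    domain is complemented, so it suffices that a vector k orthogonal to that domain vanishes. *)
Lemma closed_op_adjoint t : closed_op t -> closed_op (op_adjoint t).
Proof.
move=> [tf ts td tcl]; have [t0 tD tZ tA] := ts.
have as_ : submodule (V := ip_sum K) (op_adjoint t).
  split=> [|[x1 x2] [y1 y2]|c [x1 x2]|a [x1 x2]].
  - by apply/op_adjointE => x tx _; rewrite !(kip0l kE).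
  - move=> /op_adjointE ax /op_adjointE ay; apply/op_adjointE => x tx txx.
    by rewrite !(kipDl kE) (ax _ _ txx) (ay _ _ txx).
  - move=> /op_adjointE ax; apply/op_adjointE => x tx txx.
    by rewrite !(kipZl kE) (ax _ _ txx).
  - move=> /op_adjointE ax; apply/op_adjointE => x tx txx.
    by rewrite !(kip_act kE) (ax _ _ txx).
split=> //.
- move=> x y z /op_adjointE ay /op_adjointE az; apply/eqP; rewrite -subr_eq0; apply/eqP.
  apply: (kip_eq0 kE); apply: (kip_closedr kE) => eps eps0.
  have [w [tw wtw] xw] := td (y - z) eps eps0; exists w => //.
  by rewrite (kipBl kE) -(ay _ _ wtw) -(az _ _ wtw) subrr.
- have ds := dom_submodule as_.
  move=> z; have [m mM mP] := orthogonal_decomposition kE eh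
    (adherence_submodule kE ds) (@adherence_closed _ _ _ _ _ kE _) z.
  suff zm : z - m = 0 by rewrite -(subrK m z) zm add0r; exact: mM.
  move: (z - m) mP => k kP.
  (* Split (0, k) along G(t): orthogonality of the remainder (-x, k - tx) to G(t) says that t^* maps
     k - tx to x. As k is orthogonal to k - tx, the remainder has norm 0; thus x = 0 and k = t 0 =
     0. *)
  have [[x tx] xtx xP] := orthogonal_decomposition kS eh ts tcl (0, k).
  have wa : op_adjoint t (k - tx, x).
    apply/op_adjointE => x' tx' xtx'; have := xP _ xtx'.
    by rewrite /kip_sum /= sub0r (kipNl kE) => /eqP; rewrite addrC subr_eq0 => /eqP.
  have : kip_sum kdot (x, k - tx) (x, k - tx) = 0.
    rewrite /kip_sum /= {1}(kipBl kE) kP ?sub0r; last first.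
      by apply: (subset_adherence kE); exists x.
    have -> : kdot tx (k - tx) = kdot x x := wa _ _ xtx.
    by rewrite subrr.
  move=> /(kip_eq0 kS) [x0 /eqP]; rewrite subr_eq0 => /eqP ->.
  by apply: tf t0; rewrite -x0.
- move=> [y z] yz; apply/op_adjointE => x tx xtx.
  (* The graph of t^* is the orthogonal complement of the flipped graph of pairs (tx, -x), and
     orthogonal complements are closed. *)
  have : kip_sum kdot (y, z) (tx, - x) = 0.
    apply: (kip_closed kS) => eps /yz[[y' z'] /op_adjointE a' yz']; exists (y', z') => //.
    by rewrite /kip_sum /= kdotNr (a' _ _ xtx) subrr.
  by rewrite /kip_sum /= kdotNr => /eqP; rewrite subr_eq0 => /eqP.
Qed.

(** <x, y> = <x, y> e for y in the corner, so its value at h determines it. *)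
Lemma kdot_corner (x : E) y w :
  kdot x (corner_val y) w = hdot w h *: kdot x (corner_val y) h.
Proof.
apply: hdot_ext => v; rewrite hdotZl !(kip_adjoint kE) -{1}corner_fixed (kip_act kE).
by rewrite cop_mulE eh.2 (formZr hP) mulrC -hdotC.
Qed.

Lemma psi_adjoint t : closed_op t -> psi e (op_adjoint t) = op_adjoint (psi e t).
Proof.
move=> tc; have [_ ts _ _] := tc; apply/seteqP; split=> [[y z]|[y z] ayz].
  rewrite psiE => ayz x tx; rewrite psiE => xtx; change (ip tx y = ip x z).
  have xz : kdot (corner_val tx) (corner_val y) = kdot (corner_val x) (corner_val z).
    exact: ayz xtx.
  by rewrite !ip_corner /coef_ip xz.
rewrite psiE => x tx xtx /=; apply: cop_ext => w;
rewrite (kdot_corner tx y w) (kdot_corner x z w); congr (_ *: _).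
(* The adjoint of t_e is tested on the corner only; theta_u brings an arbitrary pair of G(t) there,
   and q_h(theta_u tx, y) = <<tx, y> h, u> recovers the missing coefficients. *)
apply: hdot_ext => u; have [_ _ _ tA] := ts.
have : ip (to_corner (kact (rank_one h u) tx)) y = ip (to_corner (kact (rank_one h u) x)) z.
  exact: ayz (psi_to_corner ts (tA (rank_one h u) _ xtx)).
rewrite !ip_corner /= !(act_e_theta kE eh) /coef_ip !(kip_act kE) !cop_mulE.
by rewrite !(rank_oneE eh) !hdotZl (projects_on_unit eh) !mulr1.
Qed.

Lemma psi_scale c t : closed_op t -> psi e (op_scale c t) = op_scale c (psi e t).
Proof.
move=> tc; apply/seteqP; split=> [[x y]|[x y] [y']]; rewrite !psiE.
  move=> [y' /= txy yy']; exists (to_corner y').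
    by rewrite psiE (psi_val tc txy).
  by apply: val_inj; rewrite /= yy' -[in LHS](psi_val tc txy).
by move=> txy /= ->; exists (corner_val y').
Qed.

Lemma psi_add t s : closed_op t -> closed_op s ->
  psi e (op_add t s) = op_add (psi e t) (psi e s).
Proof.
move=> tc sc; apply/seteqP; split=> [[x y]|[x y] [y1 [y2 []]]]; rewrite !psiE.
  move=> [y1 [y2 /= [t1 s2 yE]]]; exists (to_corner y1), (to_corner y2).
  rewrite !psiE (psi_val tc t1) (psi_val sc s2); split=> //.
  by apply: val_inj; rewrite /= yE -[in LHS](psi_val tc t1) -[in LHS](psi_val sc s2).
by move=> t1 s2 /= ->; exists (corner_val y1), (corner_val y2).
Qed.

Lemma psi_comp t s : closed_op t -> closed_op s ->
  psi e (op_comp t s) = op_comp (psi e t) (psi e s).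
Proof.
move=> tc sc; apply/seteqP; split=> [[x z]|[x z] [y]]; rewrite !psiE.
  move=> [y /= sxy tyz]; exists (to_corner y); rewrite psiE (psi_val sc sxy) //.
by move=> sxy /= tyz; exists (corner_val y).
Qed.

End CornerMap.

Theorem theorem3p9 (R : realType) (H : hilbertType R) (E : hilbertKModType H)
    (e : compact_op H) (he : minimal_projection e) :
  [/\ (* into and onto, isometric, operation preserving *)
      forall t : graph_op (kmodule E), closed_op t -> closed_op (psi e t),
      forall r : graph_op (corner_space E e), closed_op r ->
        exists2 t : graph_op (kmodule E), closed_op t & psi e t = r,
      forall t s : graph_op (kmodule E), closed_op t -> closed_op s ->
        gap t s = gap (psi e t) (psi e s) &
      [/\ forall t : graph_op (kmodule E), closed_op t ->
            closed_op (op_adjoint t) /\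
            psi e (op_adjoint t) = op_adjoint (psi e t),
          forall (c : R[i]) (t : graph_op (kmodule E)), closed_op t ->
            closed_op (op_scale c t) ->
            psi e (op_scale c t) = op_scale c (psi e t),
          forall t s : graph_op (kmodule E), closed_op t -> closed_op s ->
            closed_op (op_add t s) ->
            psi e (op_add t s) = op_add (psi e t) (psi e s) &
          forall t s : graph_op (kmodule E), closed_op t -> closed_op s ->
            closed_op (op_comp t s) ->
            psi e (op_comp t s) = op_comp (psi e t) (psi e s)]].
Proof.
have [h eh] := minimal_projection_rank_one he; split.
- by move=> t; exact: (closed_op_psi eh).
- by move=> r; exact: (psi_onto eh).
- by move=> t s; exact: (gap_psi eh).
- split.
  + by move=> t tc; split; [exact: (closed_op_adjoint eh)|exact: (psi_adjoint eh)].
  + by move=> c t tc _; exact: (psi_scale eh).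
  + by move=> t s tc sc _; exact: (psi_add eh).
  + by move=> t s tc sc _; exact: (psi_comp eh).
Qed.
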